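(* Let $k\in[1,2h-1]$ and let $X_1,X_2$ be simple objects of $\mathcal{E}(\Gamma)$, $\Gamma=\mathrm{SL}(2,q)$, each belonging to one of the families $A^u_{k'},B^{\nu',v}_{\mu',\varepsilon'},C^w_{\ell'}$. Put $X=X_1\odot X_2$, and suppose that $e^k\neq a_1^{\epsilon_1}a_2^{\epsilon_2}$ for all $\epsilon_1,\epsilon_2\in\{\pm1\}$. Let $\mathbb{G}$ be the set of $u\in[1,q-1]$ with $u\equiv\acute{\nu}\pmod 2$. (1) If neither $X_1$ nor $X_2$ belongs to the $B$-family, then $$X_{[\mathbf{a}^k]}\cong\bigoplus_{u\in\mathbb{G}}\left(A_k^u\oplus A_k^u\right).$$ (2) If at least one of $X_1,X_2$ belongs to the $B$-family, then $$X_{[\mathbf{a}^k]}\cong\bigoplus_{u\in\mathbb{G}}A_k^u.$$ Moreover, if both belong to the $B$-family, say $X_j=B^{\nu_j,v_j}_{\mu_j,\varepsilon_j}$ for $j=1,2$, then $k\equiv\acute{\varepsilon_1}-\acute{\varepsilon_2}\pmod 2$.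
   Context: General setting. For a finite group $\Gamma$, $\mathcal{E}(\Gamma)$ is the category of finite-dimensional representations of the quantum double $D(\Gamma)$. Its objects are $\Gamma$-graded finite-dimensional complex vector spaces $U=\bigoplus_{x\in\Gamma}U_x$ with a left linear action $g\mapsto L^U_g$ of $\Gamma$ with $L^U_g(U_x)=U_{gxg^{-1}}$; morphisms are grading-preserving equivariant linear maps. Tensor product: $(U\odot V)_x=\bigoplus_{x_1x_2=x}U_{x_1}\otimes V_{x_2}$ with diagonal action. For $x\in\Gamma$ and an irreducible representation $\rho$ of the centralizer $\mathrm{Cen}(x)$ on $U(\rho)$, $U(x,\rho)$ is the simple object with $U(x,\rho)_y=U(\rho)$ for $y\in[x]$ (the conjugacy class of $x$), $0$ otherwise, with the induced action: fix left coset representatives $R_x$ of $\mathrm{Cen}(x)$; for $g\in\Gamma$, $a\in R_x$ write $ga=a'b$ with $a'\in R_x$, $b\in\mathrm{Cen}(x)$, and let $L_g:U(x,\rho)_{axa^{-1}}\to U(x,\rho)_{a'xa'^{-1}}$ be $\rho(b)$. For an object $X$, $X_{[x]}=\bigoplus_{y\in[x]}X_y$ is the subobject supported on $[x]$. Notation for $\mathrm{SL}(2,q)$. $q=p^n\ge5$, $p$ an odd prime, $q=4h+1$; $\Gamma=\mathrm{SL}(2,q)$. For integers $a<b$, $[a,b]=\{a,a+1,\dots,b\}$. $\acute{+}=0$, $\acute{-}=1$; signs $\pm$ are identified with $\pm1$. $\check e$ is a fixed generator of $\mathbb{F}_{q^2}^\times$, $\tilde e=\check e^{2h+1}$, $e=\tilde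 e^2$ (a generator of $\mathbb{F}_q^\times$), $f=\check e^{4h}$; $\zeta_m=\exp(2\pi i/m)$; $\mathrm{tr}:\mathbb{F}_q\to\mathbb{F}_p$ is the trace. Let $\mathbf e$ be the identity matrix, $\mathbf{a}=\mathrm{diag}(e,e^{-1})$, $\mathbf{b}(y)=\begin{pmatrix}1&y\\0&1\end{pmatrix}$, $\mathbf{b}_\varepsilon=\mathbf{b}(e^{\acute\varepsilon})$ for $\varepsilon\in\{+,-\}$, and $\mathbf{c}=\begin{pmatrix}s_1&s_1'\tilde e^{-1}\\ s_1'\tilde e&s_1\end{pmatrix}$ with $s_1=\frac12(f+f^{-1})$, $s_1'=\frac12(f-f^{-1})$. One has $\mathrm{Cen}(\mathbf a^k)=\langle\mathbf a\rangle\cong\mathbb{Z}_{q-1}$ ($k\in[1,2h-1]$), $\mathrm{Cen}(\mu\mathbf b_\varepsilon)=\{\pm\mathbf b(c):c\in\mathbb{F}_q\}$, $\mathrm{Cen}(\mathbf c^\ell)=\langle\mathbf c\rangle\cong\mathbb{Z}_{q+1}$ ($\ell\in[1,2h]$). Simple objects with noncentral support: $A_k^u=U(\mathbf a^k,u^* )$ for $k\in[1,2h-1]$, $u\in\mathbb{Z}_{q-1}$, $u^*(\mathbf a^{i})=\zeta_{q-1}^{iu}$; $B^{\nu,v}_{\mu,\varepsilon}=U(\mu\mathbf b_\varepsilon,(\nu,v)^* )$ for $\mu,\varepsilon,\nu\in\{+,-\}$, $v\in\mathbb{F}_q$, $(\nu,v)^*(\eta\mathbf b(c))=\eta^{\acute\nu}\zeta_p^{\mathrm{tr}(vc)}$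 ($\eta=\pm1$); $C_\ell^w=U(\mathbf c^\ell,w^* )$ for $\ell\in[1,2h]$, $w\in\mathbb{Z}_{q+1}$, $w^*(\mathbf c^{i})=\zeta_{q+1}^{iw}$. The parity of $U(x,\rho)$ is even if $\rho(-\mathbf e)=1$ and odd if $\rho(-\mathbf e)=-1$. For the pair $X_1,X_2$: $a_j=e^{k'}$ if $X_j=A^u_{k'}$; $a_j=\mu'$ if $X_j=B^{\nu',v}_{\mu',\varepsilon'}$; $a_j=f^{\ell'}$ if $X_j=C^w_{\ell'}$. Let $\nu=+$ if $X_1,X_2$ have the same parity and $\nu=-$ otherwise.
   Formalization: When both X_1, X_2 are in the B-family, part (2) and its ''moreover'' are stated assuming X_{[a^k]} is nonzero (else false, e.g. q=5, k=1, X_1=X_2=B^{+,0}_{+,+}); it is also proved that k ≡ ε_1−ε_2 mod 2 (acute values) implies X_{[a^k]} is nonzero. *)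

(* Defs.v *)
From HB Require Import structures.
From mathcomp Require Import all_boot all_order all_fingroup all_algebra.
From mathcomp Require Import all_solvable all_field all_character.
From mathcomp Require Import reals trigo complex ring zify.

Set Implicit Arguments.
Unset Strict Implicit.
Unset Printing Implicit Defensive.

Import Order.TTheory GRing.Theory Num.Theory.
Local Open Scope ring_scope.

Section GradedObjects.

Variables (C : fieldType) (gT : finGroupType).

Definition grading (V : vectType C) (gr : gT -> {vspace V}) : Prop :=
  directv (\sum_x gr x) /\ (\sum_x gr x)%VS = fullv.

(* Objects of E(Gamma), Gamma = [set: gT]: a finite-dimensional C-vector space
   graded by gT, together with a left linear action L = dact such that
   L_g (U_x) = U_(g x g^-1). *)
Record dobject := DObject {
  dcar :> vectType C;
  dgr : gT -> {vspace dcar};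
  dact : gT -> 'End(dcar);
  dgr_grading : grading dgr;
  dact1 : dact 1%g = \1%VF;
  dactM : forall g h, dact (g * h)%g = (dact g \o dact h)%VF;
  dact_gr : forall g x, (dact g @: dgr x)%VS = dgr (g * x * g^-1)%g
}.

Lemma dgr_direct (U : dobject) : directv (\sum_x dgr U x).
Proof. by case: (dgr_grading U). Qed.

Lemma dgr_full (U : dobject) : (\sum_x dgr U x)%VS = fullv.
Proof. by case: (dgr_grading U). Qed.

Lemma gradingP (V : vectType C) (gr : gT -> {vspace V}) :
    (forall us : gT -> V, (forall x, us x \in gr x) -> \sum_x us x = 0 ->
      forall x, us x = 0) ->
    (forall v, exists2 us : gT -> V, forall x, us x \in gr x & v = \sum_x us x) ->
  grading gr.
Proof.
move=> indep full; split.
  by apply/directv_sum_independent=> us Hus sum0 x _; apply: indep => // y; apply: Hus.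
apply/eqP; rewrite eqEsubv subvf; apply/subvP=> v _.
by have [us Hus ->] := full v; apply: memv_sumr.
Qed.

Lemma grading_dim (V : vectType C) (gr : gT -> {vspace V}) :
  (\sum_x gr x)%VS = fullv -> (\sum_x \dim (gr x) <= \dim {:V})%N -> grading gr.
Proof. by move=> full le; split=> //; rewrite directvEgeq /= full. Qed.

Lemma gr_indep (U : dobject) (us : gT -> U) :
  (forall x, us x \in dgr U x) -> \sum_x us x = 0 -> forall x, us x = 0.
Proof.
move=> Hus sum0 x.
by apply: (directv_sum_independent (dgr_direct U) us) => // y _; apply: Hus.
Qed.

Definition dmorphism (U V : dobject) (f : 'Hom(U, V)) : Prop :=
  (forall x, (f @: dgr U x <= dgr V x)%VS) /\
  (forall g, (f \o dact U g = dact V g \o f)%VF).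

Definition diso (U V : dobject) : Prop :=
  exists f : 'Hom(U, V), exists g : 'Hom(V, U),
    [/\ dmorphism f, dmorphism g, (g \o f = \1)%VF & (f \o g = \1)%VF].

Lemma act_gr_eq (V : vectType C) (gr : gT -> {vspace V}) (act : gT -> 'End(V)) :
    act 1%g = \1%VF ->
    (forall g h, act (g * h)%g = (act g \o act h)%VF) ->
    (forall g x u, u \in gr x -> act g u \in gr (g * x * g^-1)%g) ->
  forall g x, (act g @: gr x)%VS = gr (g * x * g^-1)%g.
Proof.
move=> a1 aM agr g x; apply/eqP; rewrite eqEsubv; apply/andP; split.
  by apply/subvP=> _ /memv_imgP[u xu ->]; exact: agr.
apply/subvP=> v gv; have -> : v = act g (act g^-1%g v).
  by rewrite -comp_lfunE -aM mulgV a1 id_lfunE.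
apply: memv_img; have := agr g^-1%g _ _ gv.
by rewrite invgK !mulgA mulVg mul1g mulgKV.
Qed.

Lemma gr_decomp (U : dobject) (u : U) :
  exists2 us : gT -> U, forall x, us x \in dgr U x & u = \sum_x us x.
Proof.
have: u \in (\sum_x dgr U x)%VS by rewrite dgr_full memvf.
by case/memv_sumP=> us Hus ->; exists us => // x; apply: Hus.
Qed.

(* U (x) V is modelled by coordinates: the tensor product of the canonical bases
   of U and V is the basis of elementary matrices (tens_basis).  The map tens is
   the universal bilinear map (u, v) |-> u (x) v, and tmap f g is f (x) g, as
   characterised by tmapE. *)
Definition tens (U V : vectType C) (u : U) (v : V) : 'M[C]_(\dim {:U}, \dim {:V}) :=
  \matrix_(i, j) (coord (vbasis {:U}) i u * coord (vbasis {:V}) j v).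

Lemma tensDl (U V : vectType C) (u u' : U) (v : V) a :
  tens (a *: u + u') v = a *: tens u v + tens u' v.
Proof. by apply/matrixP=> i j; rewrite !mxE linearP mulrDl mulrA. Qed.

Lemma tensDr (U V : vectType C) (u : U) (v v' : V) a :
  tens u (a *: v + v') = a *: tens u v + tens u v'.
Proof. by apply/matrixP=> i j; rewrite !mxE linearP mulrDr mulrCA. Qed.

HB.instance Definition _ (U V : vectType C) (u : U) :=
  GRing.isLinear.Build C V 'M[C]_(\dim {:U}, \dim {:V}) _ (tens u)
    (fun a v v' => tensDr u v v' a).

Definition tensl (U V : vectType C) (v : V) (u : U) := tens u v.

HB.instance Definition _ (U V : vectType C) (v : V) :=
  GRing.isLinear.Build C U 'M[C]_(\dim {:U}, \dim {:V}) _ (@tensl U V v)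
    (fun a u u' => tensDl u u' v a).

Lemma tens_suml (U V : vectType C) I r (P : pred I) (us : I -> U) (v : V) :
  tens (\sum_(i <- r | P i) us i) v = \sum_(i <- r | P i) tens (us i) v.
Proof. exact: (linear_sum (@tensl U V v)). Qed.

Lemma tensZl (U V : vectType C) a (u : U) (v : V) : tens (a *: u) v = a *: tens u v.
Proof. by have := tensDl u 0 v a; rewrite addr0 [tens 0 v](raddf0 (@tensl U V v)) addr0. Qed.

Lemma tens_basis (U V : vectType C) i j :
  tens (vbasis {:U})`_(i : 'I_(\dim {:U})) (vbasis {:V})`_(j : 'I_(\dim {:V}))
    = delta_mx i j.
Proof.
have fU : free (vbasis {:U}) by apply: basis_free (vbasisP _).
have fV : free (vbasis {:V}) by apply: basis_free (vbasisP _).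
apply/matrixP=> i' j'; rewrite !mxE !coord_free //.
by rewrite [i == _]eq_sym [j == _]eq_sym -natrM mulnb.
Qed.

Definition tmap_fun (U V U' V' : vectType C) (f : 'Hom(U, U')) (g : 'Hom(V, V'))
    (M : 'M[C]_(\dim {:U}, \dim {:V})) : 'M[C]_(\dim {:U'}, \dim {:V'}) :=
  \sum_i \sum_j M i j *: tens (f (vbasis {:U})`_i) (g (vbasis {:V})`_j).

Lemma tmap_fun_linear U V U' V' f g : linear (@tmap_fun U V U' V' f g).
Proof.
move=> a M N; rewrite /tmap_fun scaler_sumr -big_split; apply: eq_bigr => i _.
rewrite /= scaler_sumr -big_split; apply: eq_bigr => j _ /=.
by rewrite !mxE scalerDl scalerA.
Qed.

HB.instance Definition _ U V U' V' f g :=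
  GRing.isLinear.Build C _ _ _ (@tmap_fun U V U' V' f g) (@tmap_fun_linear U V U' V' f g).

Definition tmap (U V U' V' : vectType C) (f : 'Hom(U, U')) (g : 'Hom(V, V'))
  : 'Hom('M[C]_(\dim {:U}, \dim {:V}), 'M[C]_(\dim {:U'}, \dim {:V'})) :=
  linfun (tmap_fun f g).

Lemma tmapE (U V U' V' : vectType C) (f : 'Hom(U, U')) (g : 'Hom(V, V')) u v :
  tmap f g (tens u v) = tens (f u) (g v).
Proof.
rewrite lfunE /= /tmap_fun.
rewrite [in RHS](coord_vbasis (memvf u)) [in RHS](coord_vbasis (memvf v)).
rewrite (linear_sum f) tens_suml; apply: eq_bigr => i _.
rewrite (linear_sum g) linear_sum; apply: eq_bigr => j _.
by rewrite !linearZ /= tensZl linearZ /= scalerA mxE mulrC.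
Qed.

Lemma tens_ind (U V W : vectType C)
    (f g : 'Hom('M[C]_(\dim {:U}, \dim {:V}), W)) :
  (forall u v, f (tens u v) = g (tens u v)) -> f = g.
Proof.
move=> fg; apply/lfunP=> M; rewrite (matrix_sum_delta M) !linear_sum.
apply: eq_bigr => i _; rewrite !linear_sum; apply: eq_bigr => j _.
by rewrite !linearZ /= -tens_basis fg.
Qed.

(* The image of A (x) B in U (x) V, for subspaces A and B. *)
Definition tens_vs (U V : vectType C) (A : {vspace U}) (B : {vspace V}) :
    {vspace 'M[C]_(\dim {:U}, \dim {:V})} :=
  <<[seq tens u v | u <- vbasis A, v <- vbasis B]>>%VS.

Lemma mem_tens_vs U V (A : {vspace U}) (B : {vspace V}) u v :
  u \in A -> v \in B -> tens u v \in tens_vs A B.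
Proof.
move=> Au Bv; rewrite (coord_vbasis Au) (coord_vbasis Bv).
rewrite linear_sum memv_suml // => j _; rewrite linearZ /= memvZ //.
rewrite tens_suml memv_suml // => i _.
rewrite tensZl memvZ // memv_span //.
by apply: allpairs_f; apply: mem_nth; rewrite size_tuple.
Qed.

Lemma tens_vsP U V (A : {vspace U}) (B : {vspace V})
    (W : {vspace 'M[C]_(\dim {:U}, \dim {:V})}) :
  (forall u v, u \in A -> v \in B -> tens u v \in W) -> (tens_vs A B <= W)%VS.
Proof.
move=> H; apply/span_subvP=> _ /allpairsP[[u v] /= [uA vB ->]].
by apply: H; apply: vbasis_mem.
Qed.

Lemma dim_tens_vs U V (A : {vspace U}) (B : {vspace V}) :
  (\dim (tens_vs A B) <= \dim A * \dim B)%N.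
Proof. by rewrite (leq_trans (dim_span _)) // size_allpairs !size_tuple. Qed.

Section Tensor.

Variables U V : dobject.

Definition tens_gr (x : gT) : {vspace 'M[C]_(\dim {:U}, \dim {:V})} :=
  (\sum_(p : gT * gT | (p.1 * p.2)%g == x) tens_vs (dgr U p.1) (dgr V p.2))%VS.

Definition tens_act (g : gT) := tmap (dact U g) (dact V g).

Lemma tens_gr_full : (\sum_x tens_gr x)%VS = fullv.
Proof.
apply/eqP; rewrite eqEsubv subvf; apply/subvP=> M _; rewrite (matrix_sum_delta M).
apply: memv_suml => i _; apply: memv_suml => j _; rewrite memvZ // -tens_basis.
have [us Hus ->] := gr_decomp (vbasis {:U})`_i.
have [vs Hvs ->] := gr_decomp (vbasis {:V})`_j.
rewrite linear_sum memv_suml // => y _ /=.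
rewrite tens_suml memv_suml // => x _.
have: tens (us x) (vs y) \in tens_gr (x * y)%g.
  rewrite memvE /tens_gr (bigD1 (x, y)) //=; apply: subv_trans (addvSl _ _).
  by rewrite -memvE mem_tens_vs.
by apply: subvP; rewrite (bigD1 (x * y)%g) //= addvSl.
Qed.

Lemma tens_grading : grading tens_gr.
Proof.
apply: grading_dim tens_gr_full _.
have dU : (\sum_x \dim (dgr U x))%N = \dim {:U}.
  by have /= <- := directvP (dgr_direct U); rewrite dgr_full.
have dV : (\sum_x \dim (dgr V x))%N = \dim {:V}.
  by have /= <- := directvP (dgr_direct V); rewrite dgr_full.
have le1 x : (\dim (tens_gr x) <=
    \sum_(p : gT * gT | (p.1 * p.2)%g == x) \dim (dgr U p.1) * \dim (dgr V p.2))%N.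
  by rewrite (leq_trans (dimv_leq_sum _ _ _)) // leq_sum // => p _; apply: dim_tens_vs.
apply: leq_trans (leq_sum _ _) _ => [x _|]; first exact: le1.
have <- : (\sum_(p : gT * gT) \dim (dgr U p.1) * \dim (dgr V p.2) =
    \sum_x \sum_(p : gT * gT | (p.1 * p.2)%g == x)
      \dim (dgr U p.1) * \dim (dgr V p.2))%N.
  by rewrite (partition_big (fun p : gT * gT => (p.1 * p.2)%g) predT).
rewrite -(pair_bigA _ (fun x y => (\dim (dgr U x) * \dim (dgr V y))%N)) /=.
rewrite (eq_bigr (fun x => \dim (dgr U x) * \dim {:V})%N); last first.
  by move=> x _; rewrite -big_distrr /= dV.
by rewrite -big_distrl /= dU [leqRHS]dimvf.
Qed.

Lemma tens_act1 : tens_act 1%g = \1%VF.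
Proof.
by apply: tens_ind => u v; rewrite tmapE !dact1 !id_lfunE.
Qed.

Lemma tens_actM g h : tens_act (g * h)%g = (tens_act g \o tens_act h)%VF.
Proof.
by apply: tens_ind => u v; rewrite comp_lfunE !tmapE !dactM !comp_lfunE.
Qed.

Lemma tens_act_gr g x : (tens_act g @: tens_gr x)%VS = tens_gr (g * x * g^-1)%g.
Proof.
apply: act_gr_eq tens_act1 tens_actM _ g x => g x M.
move=> xM; rewrite memv_preim; move: M xM; apply/subvP.
apply/subv_sumP=> -[y z] /= /eqP yz.
apply: tens_vsP => u v uy vz; rewrite -memv_preim tmapE.
rewrite memvE /tens_gr (bigD1 (g * y * g^-1, g * z * g^-1)%g) /=; last first.
  by rewrite -yz !mulgA mulgKV.
apply: subv_trans (addvSl _ _); rewrite -memvE; apply: mem_tens_vs.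
  by rewrite -dact_gr memv_img.
by rewrite -dact_gr memv_img.
Qed.

Definition dtensor : dobject :=
  DObject tens_grading tens_act1 tens_actM tens_act_gr.

End Tensor.

Section Zero.

Let Z : vectType C := 'rV[C]_0.

Lemma zero_grading : grading (fun=> 0%VS : {vspace Z}).
Proof.
apply: gradingP => [us _ _ x|v]; first by rewrite [us x]thinmx0.
by exists (fun=> 0) => [x|]; rewrite ?mem0v // thinmx0 big1.
Qed.

Lemma zero_actM (g h : gT) : \1%VF = (\1 \o \1)%VF :> 'End(Z).
Proof. by rewrite comp_lfun1l. Qed.

Lemma zero_act_gr (g x : gT) : (\1%VF @: (0 : {vspace Z}))%VS = 0%VS.
Proof. by rewrite limg0. Qed.

Definition dzero : dobject :=
  DObject zero_grading erefl zero_actM zero_act_gr.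

End Zero.

Section Sum.

Variables U V : dobject.
Let S : vectType C := (U * V)%type.

Definition sum_gr (x : gT) : {vspace S} :=
  (linfun (fst : S -> U) @^-1: dgr U x :&: linfun (snd : S -> V) @^-1: dgr V x)%VS.

Lemma mem_sum_gr x (w : S) :
  (w \in sum_gr x) = (w.1 \in dgr U x) && (w.2 \in dgr V x).
Proof. by rewrite memv_cap -!memv_preim !lfunE. Qed.

Definition sum_act_fun (g : gT) (w : S) : S := (dact U g w.1, dact V g w.2).

Lemma sum_act_linear g : linear (sum_act_fun g).
Proof. by move=> a w w'; rewrite /sum_act_fun /= !linearP. Qed.

HB.instance Definition _ g :=
  GRing.isLinear.Build C S S _ (sum_act_fun g) (sum_act_linear g).

Definition sum_act (g : gT) : 'End(S) := linfun (sum_act_fun g).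

Lemma sum_grading : grading sum_gr.
Proof.
apply: gradingP => [us Hus sum0 x|[u v]].
  have E1 : (us x).1 = 0.
    apply: (gr_indep (us := fun y => (us y).1)) => [y|].
      by have:= Hus y; rewrite mem_sum_gr => /andP[].
    by rewrite -(raddf_sum (fst : S -> U)) sum0.
  have E2 : (us x).2 = 0.
    apply: (gr_indep (us := fun y => (us y).2)) => [y|].
      by have:= Hus y; rewrite mem_sum_gr => /andP[].
    by rewrite -(raddf_sum (snd : S -> V)) sum0.
  by rewrite [us x]surjective_pairing E1 E2.
have [us Hus Eu] := gr_decomp u; have [vs Hvs Ev] := gr_decomp v.
exists (fun x => (us x, vs x)) => [x|]; first by rewrite mem_sum_gr /= Hus Hvs.
rewrite [RHS]surjective_pairing; congr pair.
  by rewrite Eu (raddf_sum (fst : S -> U)).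
by rewrite Ev (raddf_sum (snd : S -> V)).
Qed.

Lemma sum_act1 : sum_act 1%g = \1%VF.
Proof.
apply/lfunP=> w; rewrite lfunE /= /sum_act_fun !dact1 !id_lfunE.
by rewrite -surjective_pairing.
Qed.

Lemma sum_actM g h : sum_act (g * h)%g = (sum_act g \o sum_act h)%VF.
Proof.
by apply/lfunP=> w; rewrite comp_lfunE !lfunE /= /sum_act_fun !dactM !comp_lfunE.
Qed.

Lemma sum_act_gr g x : (sum_act g @: sum_gr x)%VS = sum_gr (g * x * g^-1)%g.
Proof.
apply: act_gr_eq sum_act1 sum_actM _ g x => g x w.
by rewrite !mem_sum_gr lfunE /= -!dact_gr => /andP[? ?]; rewrite !memv_img.
Qed.

Definition dsum : dobject :=
  DObject sum_grading sum_act1 sum_actM sum_act_gr.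

End Sum.

Section Support.

Variables (X : dobject) (x : gT).

(* dsupp X x is X_[x], the subobject of X supported on the conjugacy class of x. *)
Definition supp_vs : {vspace X} := (\sum_(y in (x ^: [set: gT])%g) dgr X y)%VS.

Definition supp_gr (y : gT) : {vspace subvs_of supp_vs} :=
  (linfun (vsval : subvs_of supp_vs -> X) @^-1: dgr X y)%VS.

Lemma mem_supp_gr y u : (u \in supp_gr y) = (vsval u \in dgr X y).
Proof. by rewrite -memv_preim lfunE. Qed.

Definition supp_act (g : gT) : 'End(subvs_of supp_vs) :=
  (linfun (vsproj supp_vs) \o dact X g \o linfun vsval)%VF.

Lemma classM g y : y \in (x ^: [set: gT])%g -> (g * y * g^-1)%g \in (x ^: [set: gT])%g.
Proof.
have -> : (g * y * g^-1)%g = (y ^ g^-1)%g by rewrite conjgE invgK mulgA.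
by case/imsetP=> z _ ->; rewrite -conjgM memJ_class ?inE.
Qed.

Lemma supp_actE g u : vsval (supp_act g u) = dact X g (vsval u).
Proof.
rewrite !comp_lfunE !lfunE /= vsprojK //.
have:= subvsP u; rewrite {2}/supp_vs; case/memv_sumP=> us Hus ->.
rewrite linear_sum memv_suml // => y Hy.
have: dact X g (us y) \in dgr X (g * y * g^-1)%g by rewrite -dact_gr memv_img ?Hus.
by apply: subvP; rewrite /supp_vs (bigD1 (g * y * g^-1)%g) ?addvSl // classM.
Qed.

Lemma supp_grading : grading supp_gr.
Proof.
apply: gradingP => [us Hus sum0 y|u].
  apply: val_inj => /=.
  apply: (gr_indep (us := fun y => vsval (us y))) => [z|].
    by rewrite -mem_supp_gr Hus.
  by rewrite -(raddf_sum vsval) sum0.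
have:= subvsP u; rewrite {2}/supp_vs; case/memv_sumP=> us Hus Eu.
pose vs y := if y \in (x ^: [set: gT])%g then us y else 0.
have Hvs y : vs y \in supp_vs.
  rewrite /vs; case: ifP => [Hy|]; last by rewrite mem0v.
  by apply: subvP (Hus _ Hy); rewrite /supp_vs (bigD1 y) ?addvSl.
exists (fun y => vsproj supp_vs (vs y)) => [y|].
  rewrite mem_supp_gr vsprojK // /vs.
  by case: ifP => [/Hus|_] //; rewrite mem0v.
apply: val_inj; rewrite /= (raddf_sum vsval) Eu big_mkcond.
by apply: eq_bigr => y _; rewrite /= vsprojK.
Qed.

Lemma supp_act1 : supp_act 1%g = \1%VF.
Proof.
by apply/lfunP=> u; apply: (val_inj : injective vsval); rewrite supp_actE dact1 !id_lfunE.
Qed.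

Lemma supp_actM g h : supp_act (g * h)%g = (supp_act g \o supp_act h)%VF.
Proof.
by apply/lfunP=> u; apply: (val_inj : injective vsval); rewrite comp_lfunE !supp_actE dactM comp_lfunE.
Qed.

Lemma supp_act_gr g y : (supp_act g @: supp_gr y)%VS = supp_gr (g * y * g^-1)%g.
Proof.
apply: act_gr_eq supp_act1 supp_actM _ g y => g y u.
by rewrite !mem_supp_gr supp_actE -dact_gr => ?; apply: memv_img.
Qed.

Definition dsupp : dobject :=
  DObject supp_grading supp_act1 supp_actM supp_act_gr.

End Support.

Section Simple.

Variables (x : gT) (n : nat) (rho : mx_representation C 'C[x]%g n).

Definition cls := {y : gT | y \in (x ^: [set: gT])%g}.

(* A fixed choice of representatives of the left cosets of 'C[x]: the coset
   {a | a x a^-1 = y} is attached to the element y of the class of x. *)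
Definition crep (y : gT) : gT := repr [set a | (a * x * a^-1)%g == y].

Lemma crepP (y : cls) : (crep (val y) * x * (crep (val y))^-1)%g = val y.
Proof.
case: y => _ /= /imsetP[z _ ->].
suff: crep (x ^ z) \in [set a | (a * x * a^-1)%g == x ^ z]%g by rewrite inE => /eqP.
by apply: (mem_repr z^-1%g); rewrite inE invgK conjgE mulgA.
Qed.

Lemma classJ g (y : gT) : y \in (x ^: [set: gT])%g -> (g^-1 * y * g)%g \in (x ^: [set: gT])%g.
Proof. by move=> Hy; rewrite -{2}[g]invgK classM. Qed.

Definition clsJ (g : gT) (y : cls) : cls := Sub (g^-1 * val y * g)%g (classJ g (valP y)).

(* The element b of 'C[x] such that g a = a' b, where a' and a represent y and
   g^-1 y g respectively. *)
Definition shift (g : gT) (y : cls) : gT :=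
  ((crep (val y))^-1 * g * crep (val (clsJ g y)))%g.

Lemma shift_cent g y : shift g y \in 'C[x]%g.
Proof.
apply/cent1P; rewrite /commute /shift.
have Eb := crepP y; have /= Ea := crepP (clsJ g y).
set a := crep _ in Ea *; set b := crep (val y) in Eb *.
have Eab : (a * x * a^-1 = g^-1 * (b * x * b^-1) * g)%g by rewrite Ea Eb.
have {}Eab : (a * x = g^-1 * b * x * b^-1 * g * a)%g.
  by apply: (mulIg a^-1%g); rewrite Eab !mulgA mulgK.
rewrite -[(_ * a * x)%g]mulgA Eab !mulgA mulgK mulVg mul1g.
by [].
Qed.

(* U(x, rho): a vector is a family (phi y)_(y in [x]) of elements of
   U(rho) = 'cV_n, and rho acts on column vectors from the left. *)
Let W : vectType C := {ffun cls -> 'cV[C]_n}.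

Definition away (y : gT) (phi : W) : W :=
  [ffun z => if val z == y then 0 else phi z].

Fact away_linear y : linear (away y).
Proof.
move=> a u v; apply/ffunP=> z; rewrite !ffunE; case: ifP => // _.
by rewrite scaler0 addr0.
Qed.

HB.instance Definition _ y := GRing.isLinear.Build C W W _ (away y) (away_linear y).

Definition simple_gr (y : gT) : {vspace W} := lker (linfun (away y)).

Lemma mem_simple_gr y (phi : W) :
  reflect (forall z, val z != y -> phi z = 0) (phi \in simple_gr y).
Proof.
rewrite memv_ker lfunE; apply: (iffP eqP) => [/ffunP E z /negbTE zy|H].
  by have:= E z; rewrite !ffunE zy.
apply/ffunP=> z; rewrite !ffunE; case: ifP => // /negbT; exact: H.
Qed.

Definition simple_act_fun (g : gT) (phi : W) : W :=
  [ffun y => rho (shift g y) *m phi (clsJ g y)].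

Fact simple_act_linear g : linear (simple_act_fun g).
Proof.
move=> a u v; apply/ffunP=> z; rewrite !ffunE.
by rewrite mulmxDr -scalemxAr.
Qed.

HB.instance Definition _ g :=
  GRing.isLinear.Build C W W _ (simple_act_fun g) (simple_act_linear g).

Definition simple_act (g : gT) : 'End(W) := linfun (simple_act_fun g).

Lemma simple_grading : grading simple_gr.
Proof.
apply: gradingP => [us Hus sum0 y|phi].
  apply/ffunP=> z; have [->|zy] := eqVneq y (val z); last first.
    by rewrite (mem_simple_gr _ _ (Hus y)) ?ffunE // eq_sym.
  have := congr1 (fun f : W => f z) sum0; rewrite sum_ffunE (bigD1 (val z)) //=.
  rewrite big1 ?addr0 // => t tz.
  by rewrite (mem_simple_gr _ _ (Hus t)) // eq_sym.
exists (fun y => [ffun z => if val z == y then phi z else 0] : W) => [y|].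
  by apply/mem_simple_gr=> z /negbTE zy; rewrite ffunE zy.
apply/ffunP=> z; rewrite sum_ffunE (bigD1 (val z)) //= ffunE eqxx.
rewrite big1 ?addr0 // => t; rewrite ffunE eq_sym => /negbTE tz.
by rewrite tz.
Qed.

Lemma simple_act1 : simple_act 1%g = \1%VF.
Proof.
apply/lfunP=> phi; rewrite lfunE id_lfunE; apply/ffunP=> y; rewrite ffunE.
have E : clsJ 1%g y = y by apply: val_inj; rewrite /= invg1 mul1g mulg1.
by rewrite /shift E mulg1 mulVg repr_mx1 mul1mx.
Qed.

Lemma simple_actM g h : simple_act (g * h)%g = (simple_act g \o simple_act h)%VF.
Proof.
apply/lfunP=> phi; rewrite comp_lfunE !lfunE; apply/ffunP=> y; rewrite !ffunE mulmxA.
have E : clsJ (g * h)%g y = clsJ h (clsJ g y).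
  by apply: val_inj; rewrite /= invMg !mulgA.
rewrite -repr_mxM ?shift_cent // E; congr (_ *m _); congr (rho _).
by rewrite /shift E !mulgA mulgK.
Qed.

Lemma simple_act_gr g y :
  (simple_act g @: simple_gr y)%VS = simple_gr (g * y * g^-1)%g.
Proof.
apply: act_gr_eq simple_act1 simple_actM _ g y => g y phi /mem_simple_gr H.
apply/mem_simple_gr=> z zy; rewrite lfunE ffunE H ?mulmx0 //=.
by apply: contra_neq zy => <-; rewrite !mulgA mulgV mul1g mulgK.
Qed.

Definition dsimple : dobject :=
  DObject simple_grading simple_act1 simple_actM simple_act_gr.

End Simple.

End GradedObjects.

Section Matrices2.

Variable F : comNzRingType.

Definition mat2 (a b c d : F) : 'M[F]_2 :=
  \matrix_(i, j) if i == 0 then (if j == 0 then a else b)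
                 else (if j == 0 then c else d).

Lemma mat2P (A B : 'M[F]_2) :
  A 0 0 = B 0 0 -> A 0 1 = B 0 1 -> A 1 0 = B 1 0 -> A 1 1 = B 1 1 -> A = B.
Proof.
move=> ? ? ? ?; apply/matrixP=> i j.
have I2 (l : 'I_2) : {l = 0} + {l = 1}.
  by case: l => [[|[|//]]] H; [left | right]; apply: val_inj.
by case: (I2 i) => ->; case: (I2 j) => ->.
Qed.

Lemma mul2E (A B : 'M[F]_2) i j : (A *m B) i j = A i 0 * B 0 j + A i 1 * B 1 j.
Proof.
rewrite mxE !big_ord_recl big_ord0 addr0.
by congr (_ * _ + A _ _ * B _ _); apply: val_inj.
Qed.

Lemma det2E (A : 'M[F]_2) : \det A = A 0 0 * A 1 1 - A 0 1 * A 1 0.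
Proof.
rewrite (expand_det_row _ 0) !big_ord_recl big_ord0 addr0 /cofactor.
have -> : lift 0 0 = 1 :> 'I_2 by apply: val_inj.
rewrite !det_mx11 !mxE /= !add0n expr0 expr1 mul1r mulN1r mulrN.
by congr (_ * A _ _ - _ * A _ _); apply: val_inj.
Qed.

End Matrices2.

Section SL2Type.

Variable F : finFieldType.

Record sl2 := SL2 { sl2_mx :> 'M[F]_2; sl2_det : \det sl2_mx == 1 }.

HB.instance Definition _ := [isSub for sl2_mx].
HB.instance Definition _ := [Finite of sl2 by <:].

Fact sl2_one_det : \det (1%:M : 'M[F]_2) == 1. Proof. by rewrite det1. Qed.
Fact sl2_mul_det (A B : sl2) : \det (sl2_mx A *m sl2_mx B) == 1.
Proof. by rewrite det_mulmx (eqP (sl2_det A)) (eqP (sl2_det B)) mulr1. Qed.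
Fact sl2_inv_det (A : sl2) : \det (invmx (sl2_mx A)) == 1.
Proof. by rewrite det_inv (eqP (sl2_det A)) invr1. Qed.

Definition sl2_one := SL2 sl2_one_det.
Definition sl2_mul A B := SL2 (sl2_mul_det A B).
Definition sl2_inv A := SL2 (sl2_inv_det A).

Fact sl2_mulA : associative sl2_mul.
Proof. by move=> A B D; apply: val_inj; rewrite /= mulmxA. Qed.
Fact sl2_mul1 : left_id sl2_one sl2_mul.
Proof. by move=> A; apply: val_inj; rewrite /= mul1mx. Qed.
Fact sl2_mulV : left_inverse sl2_one sl2_inv sl2_mul.
Proof.
move=> A; apply: val_inj; rewrite /= mulVmx //.
by rewrite unitmxE (eqP (sl2_det A)) unitr1.
Qed.

HB.instance Definition _ := Finite_isGroup.Build sl2 sl2_mulA sl2_mul1 sl2_mulV.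

Lemma sl2_eqP (A B : sl2) : A 0 0 = B 0 0 -> A 0 1 = B 0 1 ->
  A 1 0 = B 1 0 -> A 1 1 = B 1 1 -> A = B.
Proof. by move=> *; apply: val_inj; apply: mat2P. Qed.

Lemma sl2_M (A B : sl2) i j : (A * B)%g i j = A i 0 * B 0 j + A i 1 * B 1 j.
Proof. exact: mul2E. Qed.

Lemma sl2_1 i j : (1%g : sl2) i j = (i == j)%:R.
Proof. by rewrite mxE. Qed.

Lemma sl2_detE (A : sl2) : A 0 0 * A 1 1 - A 0 1 * A 1 0 = 1.
Proof. by rewrite -det2E (eqP (sl2_det A)). Qed.

End SL2Type.

Section CyclicCharacter.

Variables (K : fieldType) (gT : finGroupType).

(* The least i with z ^+ i = g, when g is a power of z. *)
Definition dlog (z g : gT) : nat := find (fun i => (z ^+ i)%g == g) (iota 0 #[z]%g).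

Lemma dlogK z g : g \in <[z]>%g -> (z ^+ dlog z g)%g = g.
Proof.
case/cyclePmin=> i lti ->.
have Hh : has (fun j => (z ^+ j)%g == (z ^+ i)%g) (iota 0 #[z]%g).
  by apply/hasP; exists i => //; rewrite mem_iota.
have lt : (dlog z (z ^+ i)%g < #[z]%g)%N by rewrite has_find size_iota in Hh.
by have := nth_find 0%N Hh; rewrite nth_iota // => /eqP.
Qed.

Lemma dlogX z (w : K) i : w ^+ #[z]%g = 1 -> w ^+ dlog z (z ^+ i)%g = w ^+ i.
Proof.
move=> w1; have /eqP := dlogK (mem_cycle z i); rewrite eq_expg_mod_order => /eqP E.
by rewrite -(expr_mod _ w1) E expr_mod.
Qed.

Lemma cyc_repr (z : gT) (w : K) (G : {set gT}) :
    w ^+ #[z]%g = 1 -> G \subset <[z]>%g ->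
  mx_repr G (fun g => (w ^+ dlog z g)%:M : 'M[K]_1).
Proof.
move=> w1 /subsetP sG; split=> [|g h /sG/cycleP[i ->] /sG/cycleP[j ->]].
  by rewrite -(expg0 z) dlogX.
by rewrite -expgD !dlogX // -scalar_mxM exprD.
Qed.

End CyclicCharacter.

Lemma fixed_image (L : fieldType) (T : finType) (g : T -> L) m :
    injective g -> #|T| = m -> (1 < m)%N -> (forall t, g t ^+ m = g t) ->
  forall x, x ^+ m = x -> exists t, g t = x.
Proof.
move=> ginj cT m1 gm x xm.
have [/mapP[t _ ->]|xN] := boolP (x \in [seq g t | t <- enum T]); first by exists t.
pose P : {poly L} := 'X^m - 'X.
have sP : size P = m.+1 by rewrite size_polyDl size_polyXn // size_polyN size_polyX.
have P0 : P != 0 by rewrite -size_poly_eq0 sP.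
have rP y : root P y = (y ^+ m == y).
  by rewrite rootE !hornerE subr_eq0.
have := @max_poly_roots _ P (x :: [seq g t | t <- enum T]) P0.
rewrite /= rP xm eqxx xN (map_inj_uniq ginj) enum_uniq sP size_map -cardE cT ltnn.
have -> : all (root P) [seq g t | t <- enum T].
  by apply/allP=> _ /mapP[t _ ->]; rewrite rP gm.
by move=> /(_ isT isT).
Qed.

Section Zeta.

Variable R : realType.

(* exp (2 pi i / m) *)
Definition zeta (m : nat) : R[i] :=
  (cos (2 * pi / m%:R) +i* sin (2 * pi / m%:R))%C.

Lemma zetaX m i : zeta m ^+ i =
  (cos (i%:R * (2 * pi / m%:R)) +i* sin (i%:R * (2 * pi / m%:R)))%C.
Proof.
elim: i => [|i IH]; first by rewrite mul0r cos0 sin0.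
rewrite exprSr IH /zeta; set t := 2 * pi / _.
have -> : i.+1%:R * t = i%:R * t + t by rewrite -natr1 mulrDl mul1r.
by rewrite cosD sinD; apply/eqP; rewrite eq_complex /= eqxx /= addrC.
Qed.

Lemma zeta_unity m : (0 < m)%N -> zeta m ^+ m = 1.
Proof.
move=> m0; have m1 : m%:R != 0 :> R by rewrite pnatr_eq0 -lt0n.
by rewrite zetaX mulrC divfK // mulr_natl cos2pi sin2pi.
Qed.

End Zeta.

(* dF is the field with q = p ^ n elements, dK the field with q ^ 2 elements,
   diota the inclusion of dF in dK, and dgen a generator of dK^*. *)
Record sl2_data := SL2Data {
  dp : nat; dn : nat; dh : nat;
  dF : finFieldType;
  dK : finFieldType;
  diota : {rmorphism dF -> dK};
  dgen : dK;
  dp_prime : prime dp;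
  dp_odd : odd dp;
  dq_def : (dp ^ dn = 4 * dh + 1)%N;
  dq_ge5 : (5 <= dp ^ dn)%N;
  dF_card : #|dF| = (dp ^ dn)%N;
  dK_card : #|dK| = ((dp ^ dn) ^ 2)%N;
  dgen_prim : (#|dK|.-1).-primitive_root dgen
}.

Section SL2q.

Variable D : sl2_data.

Local Notation F := (dF D).
Local Notation K := (dK D).
Local Notation iota := (diota D).
Local Notation h := (dh D).
Local Notation p := (dp D).
Local Notation n := (dn D).
Local Notation ce := (dgen D).

Definition q : nat := #|F|.

Lemma qE : q = (4 * h).+1.
Proof. by rewrite /q dF_card dq_def addn1. Qed.

Lemma h_gt0 : (0 < h)%N.
Proof. by have := dq_ge5 D; rewrite -dF_card -/q qE; case: h. Qed.

Lemma K_order : #|K|.-1 = (4 * h * (4 * h).+2)%N.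
Proof. by rewrite dK_card -dF_card -/q qE; lia. Qed.


Lemma K_unit (x : K) : x != 0 -> x ^+ #|K|.-1 = 1.
Proof.
move=> x0; apply: (mulfI x0); rewrite -exprS mulr1 prednK ?expf_card //.
by rewrite dK_card expn_gt0 -dF_card -/q qE.
Qed.

Lemma K_log (x : K) : x != 0 -> exists i, x = ce ^+ i.
Proof.
by move=> /K_unit /(prim_rootP (dgen_prim D))[i ->]; exists i.
Qed.

Lemma iota_q (x : F) : iota x ^+ q = iota x.
Proof. by rewrite -rmorphXn expf_card. Qed.

Lemma iota_onto (x : K) : x ^+ q = x -> exists y, iota y = x.
Proof.
apply: fixed_image (fmorph_inj _) erefl _ iota_q x.
by rewrite -/q qE ltnS muln_gt0 h_gt0.
Qed.

(* The inverse of the inclusion iota on its image, which is the set of fixed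
   points of x |-> x ^+ q. *)
Definition toF (x : K) : F := odflt 0 [pick y | iota y == x].

Lemma toFK (x : K) : x ^+ q = x -> iota (toF x) = x.
Proof.
move=> /iota_onto[y0 Hy]; rewrite /toF; case: pickP => [y /eqP //|/(_ y0)].
by rewrite Hy eqxx.
Qed.

Lemma F_pchar : p \in [pchar F].
Proof. exact: card_finPcharP (dF_card D) (dp_prime D). Qed.

Lemma K_pchar : p \in [pchar K].
Proof. by apply: (card_finPcharP (n := n * 2)) (dp_prime D); rewrite dK_card expnM. Qed.

Lemma frobD (x y : K) : (x + y) ^+ q = x ^+ q + y ^+ q.
Proof.
apply: exprDn_pchar; rewrite /q dF_card pnatX; apply/orP; left.
by rewrite pnatE ?dp_prime // K_pchar.
Qed.

Lemma frobN (x : K) : (- x) ^+ q = - x ^+ q.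
Proof. by rewrite exprNn -signr_odd qE /= oddM /= expr1 mulN1r. Qed.

Lemma two_neq0 (L : fieldType) : p \in [pchar L] -> 2%:R != 0 :> L.
Proof.
move=> pL; rewrite -(dvdn_pcharf pL) dvdn_prime2 ?dp_prime //.
by apply/eqP=> p2; have := dp_odd D; rewrite p2.
Qed.

Lemma F_Nneq1 : (-1 : F) != 1.
Proof. by rewrite eq_sym -subr_eq0 opprK; apply: (two_neq0 F_pchar). Qed.

Lemma half_q : (2%:R^-1 : K) ^+ q = 2%:R^-1.
Proof. by rewrite exprVn -(rmorph_nat iota) iota_q. Qed.

Lemma ce_neq0 : ce != 0.
Proof.
have := prim_expr_order (dgen_prim D); rewrite K_order -(prednK h_gt0).
by apply: contra_eqN => /eqP ->; rewrite expr0n eq_sym oner_eq0.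
Qed.

(* te, e, f, s1, s1' are e~, e, f, s_1, s_1'; signs are encoded by booleans, with
   true for the sign -, so that the exponents 0 for + and 1 for - are the
   coercion of booleans to natural numbers, and the sign itself is (-1) ^+ b. *)
Definition te : K := ce ^+ (2 * h + 1).
Definition e : F := toF (te ^+ 2).
Definition f : K := ce ^+ (4 * h).
Definition s1 : K := 2%:R^-1 * (f + f^-1).
Definition s1' : K := 2%:R^-1 * (f - f^-1).

Lemma te_neq0 : te != 0. Proof. exact: expf_neq0 ce_neq0. Qed.
Lemma f_neq0 : f != 0. Proof. exact: expf_neq0 ce_neq0. Qed.

Lemma ce_half : ce ^+ (4 * h * (2 * h + 1)) = -1.
Proof.
have: (ce ^+ (4 * h * (2 * h + 1))) ^+ 2 = 1.
  rewrite -exprM; have := prim_expr_order (dgen_prim D); rewrite K_order => <-.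
  by congr (_ ^+ _); lia.
move/eqP; rewrite sqrf_eq1 => /orP[|/eqP //].
rewrite -(prim_order_dvd (dgen_prim D)) K_order.
by move/dvdn_leq; have := h_gt0; nia.
Qed.

Lemma te_q : te ^+ q = - te.
Proof.
rewrite qE exprS -[RHS]mulrN1; congr (_ * _).
by rewrite -exprM -ce_half mulnC.
Qed.

Lemma iota_e : iota e = te ^+ 2.
Proof. by apply: toFK; rewrite -exprM mulnC exprM te_q sqrrN. Qed.

Lemma f_q1 : f ^+ q.+1 = 1.
Proof. by rewrite qE -exprM -K_order (prim_expr_order (dgen_prim D)). Qed.

Lemma f_q : f ^+ q = f^-1.
Proof. by apply: (mulfI f_neq0); rewrite -exprS f_q1 divff // f_neq0. Qed.

Lemma s1_q : s1 ^+ q = s1.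
Proof. by rewrite exprMn half_q frobD exprVn f_q invrK addrC. Qed.

Lemma s1'_q : s1' ^+ q = - s1'.
Proof. by rewrite exprMn half_q frobD frobN exprVn f_q invrK -mulrN opprB addrC. Qed.

Lemma iota_c00 : iota (toF s1) = s1. Proof. exact: toFK s1_q. Qed.
Lemma iota_c01 : iota (toF (s1' * te^-1)) = s1' * te^-1.
Proof. by apply: toFK; rewrite exprMn exprVn s1'_q te_q invrN mulrNN. Qed.
Lemma iota_c10 : iota (toF (s1' * te)) = s1' * te.
Proof. by apply: toFK; rewrite exprMn s1'_q te_q mulrNN. Qed.

Lemma e_prim : q.-1.-primitive_root e.
Proof.
rewrite -(fmorph_primitive_root iota) iota_e /te -exprM.
have -> : ((2 * h + 1) * 2 = #|K|.-1 %/ q.-1)%N.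
  by rewrite K_order qE /= mulKn ?muln_gt0 ?h_gt0 //; lia.
apply: (dvdn_prim_root (dgen_prim D)).
by rewrite K_order qE /= dvdn_mulr.
Qed.

Lemma f_prim : q.+1.-primitive_root f.
Proof.
have -> : f = ce ^+ (#|K|.-1 %/ q.+1).
  by rewrite K_order qE mulnK.
apply: (dvdn_prim_root (dgen_prim D)).
by rewrite K_order qE dvdn_mull.
Qed.

Lemma e_neq0 : e != 0.
Proof. by rewrite -(fmorph_eq0 iota) iota_e expf_neq0 ?te_neq0. Qed.

Lemma e_log (x : F) : x != 0 -> exists i, x = e ^+ i.
Proof.
move=> x0; have x1 : x ^+ q.-1 = 1.
  by apply: (mulfI x0); rewrite -exprS mulr1 prednK ?expf_card // qE.
by have [i ->] := prim_rootP e_prim x1; exists i.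
Qed.

(* ba, bb y, bbe eps, bc are the matrices a, b(y), b_eps, c, and bs mu is the
   central element mu times the identity. *)
Fact ba_det : \det (mat2 e 0 0 e^-1) == 1.
Proof. by rewrite det2E !mxE /= mulr0 subr0 divff // e_neq0. Qed.
Definition ba : sl2 F := SL2 ba_det.

Fact bb_det y : \det (mat2 1 y 0 1 : 'M[F]_2) == 1.
Proof. by rewrite det2E !mxE /= mulr0 subr0 mulr1. Qed.
Definition bb (y : F) : sl2 F := SL2 (bb_det y).

Fact bs_det (mu : bool) : \det (((-1) ^+ mu)%:M : 'M[F]_2) == 1.
Proof. by rewrite det_scalar -exprM mulnC exprM sqrrN expr1n expr1n. Qed.
Definition bs (mu : bool) : sl2 F := SL2 (bs_det mu).

Fact bc_det : \det (mat2 (toF s1) (toF (s1' * te^-1)) (toF (s1' * te)) (toF s1)) == 1.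
Proof.
rewrite det2E !mxE /= -(inj_eq (fmorph_inj iota)) rmorphB !rmorphM rmorph1.
rewrite /= iota_c00 iota_c01 iota_c10 /s1 /s1'.
have := two_neq0 K_pchar; have := f_neq0; have := te_neq0.
move: te f => x y x0 y0 t0; apply/eqP; field.
by rewrite x0 y0 t0.
Qed.
Definition bc : sl2 F := SL2 bc_det.

Definition bbe (eps : bool) : sl2 F := bb (e ^+ eps).

Lemma baX k : (ba ^+ k)%g = mat2 (e ^+ k) 0 0 (e ^- k) :> 'M[F]_2.
Proof.
elim: k => [|k IH].
  by apply: mat2P; rewrite ?mxE //= expr0 invr1.
rewrite expgSr; have M i j := sl2_M (ba ^+ k)%g ba i j.
by apply: mat2P; rewrite M IH !mxE /= ?(mulr0, mul0r, addr0, add0r) // exprSr // invfM mulrC.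
Qed.

Lemma cent_ba k : (1 <= k <= 2 * h - 1)%N -> 'C[(ba ^+ k)%g]%g = <[ba]>%g.
Proof.
move=> kh; apply/eqP; rewrite eqEsubset; apply/andP; split; last first.
  by rewrite cycle_subG; apply/cent1P; apply: commuteX.
apply/subsetP=> g /cent1P; rewrite /commute => /(congr1 (@sl2_mx F)) /matrixP E.
have := E 0 1; have := E 1 0.
rewrite !mul2E baX !mxE /= !(mulr0, mul0r, addr0, add0r).
have ek : e ^- k - e ^+ k != 0.
  rewrite subr_eq0 eq_sym -(inj_eq (mulIf (expf_neq0 k e_neq0))).
  rewrite mulVf ?expf_neq0 ?e_neq0 // -exprD -(prim_order_dvd e_prim) qE.
  apply/negP=> /dvdn_leq; have := kh; lia.
move=> E10 E01.
have g10 : g 1 0 = 0.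
  by apply: (mulfI ek); rewrite mulr0 mulrBl -E10 mulrC subrr.
have g01 : g 0 1 = 0.
  by apply: (mulfI ek); rewrite mulr0 mulrBl -E01 mulrC subrr.
have := sl2_detE g; rewrite g10 mulr0 subr0 => det1.
have g00 : g 0 0 != 0.
  by apply: contra_eq_neq det1 => ->; rewrite mul0r eq_sym oner_eq0.
have [i Ei] := e_log g00; apply/cycleP; exists i; apply: val_inj.
rewrite /= baX; apply: mat2P; rewrite !mxE //= -Ei //.
by apply: (mulfI g00); rewrite det1 divff.
Qed.

(* formC g says that (1, te) is an eigenvector of g; lam g is the eigenvalue. *)
Definition lam (g : sl2 F) : K := iota (g 0 0) + te * iota (g 0 1).
Definition formC (g : sl2 F) : Prop := g 1 0 = e * g 0 1 /\ g 1 1 = g 0 0.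

Lemma formC1 : formC 1%g.
Proof. by rewrite /formC !sl2_1 mulr0. Qed.

Lemma lam1 : lam 1%g = 1.
Proof. by rewrite /lam !sl2_1 rmorph1 rmorph0 mulr0 addr0. Qed.

Lemma formCM g g' : formC g -> formC g' -> formC (g * g')%g.
Proof.
by rewrite /formC !sl2_M => -[-> ->] [-> ->]; split; ring.
Qed.

Lemma lamM g g' : formC g' -> lam (g * g')%g = lam g * lam g'.
Proof.
rewrite /formC /lam !sl2_M => -[-> ->].
by rewrite !rmorphD !rmorphM /= iota_e; ring.
Qed.

Lemma formC_c : formC bc.
Proof.
split; rewrite !mxE //=; apply: (fmorph_inj iota).
by rewrite rmorphM /= iota_e iota_c01 iota_c10; have := te_neq0; move: te => x ?; field.
Qed.

Lemma lam_c : lam bc = f.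
Proof.
rewrite /lam !mxE /= iota_c00 iota_c01 /s1 /s1'.
have := two_neq0 K_pchar; have := f_neq0; have := te_neq0.
by move: te f => x y x0 y0 t0; field; rewrite x0 y0 t0.
Qed.

Lemma lam_inj g g' : formC g -> formC g' -> lam g = lam g' -> g = g'.
Proof.
move=> [E1 E2] [E1' E2'] /eqP; rewrite /lam -subr_eq0.
have -> : iota (g 0 0) + te * iota (g 0 1) - (iota (g' 0 0) + te * iota (g' 0 1))
   = iota (g 0 0 - g' 0 0) + te * iota (g 0 1 - g' 0 1) by rewrite !rmorphB /=; ring.
rewrite addr_eq0 => /eqP E.
have b0 : g 0 1 - g' 0 1 = 0.
  apply/eqP; apply: contraTT isT => b1.
  have /eqP: te ^+ q = te.
    have b2 : iota (g 0 1 - g' 0 1) != 0 by rewrite fmorph_eq0.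
    have -> : te = iota (- (g 0 0 - g' 0 0) / (g 0 1 - g' 0 1)).
      by rewrite fmorph_div rmorphN /= E opprK mulfK.
    by rewrite iota_q.
  rewrite te_q eq_sym -subr_eq0 opprK -mulr2n -mulr_natl mulf_eq0.
  by rewrite (negbTE te_neq0) (negbTE (two_neq0 K_pchar)).
move: E; rewrite b0 rmorph0 mulr0 oppr0 => /eqP.
rewrite fmorph_eq0 subr_eq0 => /eqP a0; move/eqP: b0; rewrite subr_eq0 => /eqP b0.
by apply: sl2_eqP; rewrite ?E1 ?E1' ?E2 ?E2' ?a0 ?b0.
Qed.

Lemma formC_cX l : formC (bc ^+ l)%g.
Proof.
elim: l => [|l IH]; first exact: formC1.
by rewrite expgSr; apply: formCM IH formC_c.
Qed.

Lemma lam_cX l : lam (bc ^+ l)%g = f ^+ l.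
Proof.
elim: l => [|l IH]; first by rewrite lam1.
by rewrite expgSr lamM ?IH ?lam_c ?exprSr //; apply: formC_c.
Qed.

Lemma cent_bc l : (1 <= l <= 2 * h)%N -> 'C[(bc ^+ l)%g]%g = <[bc]>%g.
Proof.
move=> lh; apply/eqP; rewrite eqEsubset; apply/andP; split; last first.
  by rewrite cycle_subG; apply/cent1P; apply: commuteX.
apply/subsetP=> g /cent1P; rewrite /commute => E.
have [F1 F2] := formC_cX l; set d := (bc ^+ l)%g in E F1 F2.
have d01 : d 0 1 != 0.
  apply/eqP=> d01; have := sl2_detE d; rewrite F1 F2 d01 mulr0 mul0r subr0 => d2.
  have /eqP : f ^+ (l * 2) = 1.
    rewrite exprM -lam_cX -/d /lam d01 rmorph0 mulr0 addr0 -rmorphXn /=.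
    by rewrite expr2 d2 rmorph1.
  rewrite -(prim_order_dvd f_prim) qE => /dvdn_leq; move: lh; lia.
have /(congr1 (fun x : sl2 F => x 0 0)) := E; have /(congr1 (fun x : sl2 F => x 0 1)) := E.
rewrite !sl2_M F1 F2 => E01 E00.
have g10 : g 1 0 = e * g 0 1.
  apply: (mulfI d01); apply/eqP; rewrite -subr_eq0; apply/eqP.
  transitivity (d 0 0 * g 0 0 + d 0 1 * g 1 0 - (g 0 0 * d 0 0 + g 0 1 * (e * d 0 1))).
    by ring.
  by rewrite E00 subrr.
have g11 : g 1 1 = g 0 0.
  apply: (mulfI d01); apply/eqP; rewrite -subr_eq0; apply/eqP.
  transitivity (d 0 0 * g 0 1 + d 0 1 * g 1 1 - (g 0 0 * d 0 1 + g 0 1 * d 0 0)).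
    by ring.
  by rewrite E01 subrr.
have gC : formC g by [].
have g_norm : lam g ^+ q.+1 = 1.
  rewrite exprS /lam frobD exprMn !iota_q te_q.
  have := congr1 iota (sl2_detE g); rewrite g10 g11 rmorphB !rmorphM /= iota_e rmorph1.
  by move=> <-; ring.
have [i Ei] := prim_rootP f_prim g_norm.
apply/cycleP; exists (nat_of_ord i); apply: lam_inj => //; first exact: formC_cX.
by rewrite lam_cX.
Qed.


(* The trace of dF over its prime field, as the sum of the conjugates; tr x is
   the corresponding element of 'F_p, whose value as a natural number is used as
   an exponent of zeta p. *)
Definition trF (x : F) : F := \sum_(i < n) x ^+ (p ^ i).

Definition tr (x : F) : 'F_p := odflt 0 [pick j : 'F_p | (j : nat)%:R == trF x].

Lemma frobDp (x y : F) i : (x + y) ^+ (p ^ i) = x ^+ (p ^ i) + y ^+ (p ^ i).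
Proof.
by apply: exprDn_pchar; rewrite pnatX pnatE ?dp_prime // F_pchar.
Qed.

Lemma natr_eq_mod (i j : nat) : i%:R = j%:R :> F -> (i = j %[mod p])%N.
Proof.
wlog le : i j / (i <= j)%N => [H|] E.
  by have [/H|/ltnW/H] := leqP i j => ->.
apply/eqP; rewrite eq_sym eqn_mod_dvd // (dvdn_pcharf F_pchar) natrB // E.
by rewrite subrr.
Qed.

Lemma trK (x : F) : (tr x : nat)%:R = trF x.
Proof.
have p1 := prime_gt1 (dp_prime D).
have [j0 Hj] : exists j : 'F_p, (j : nat)%:R = trF x.
  apply: (@fixed_image _ _ (fun j : 'F_p => (j : nat)%:R) p).
  - move=> i j /natr_eq_mod E; apply: val_inj => /=.
    by move: E; rewrite !modn_small // -[X in (_ < X)%N](Fp_cast (dp_prime D)) ltn_ord.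
  - exact: card_Fp (dp_prime D).
  - exact: p1.
  - by move=> j; rewrite -(pFrobenius_autE F_pchar) rmorph_nat.
  rewrite /trF -(pFrobenius_autE F_pchar) rmorph_sum /=.
  have n0 : (0 < n)%N by have := dq_ge5 D; case: (n).
  rewrite -(prednK n0) big_ord_recr [in RHS]big_ord_recl /= addrC; congr (_ + _).
    by rewrite pFrobenius_autE -exprM -expnSr prednK // -dF_card expf_card.
  by apply: eq_bigr => i _; rewrite pFrobenius_autE -exprM -expnSr.
by rewrite /tr; case: pickP => [j /eqP //|/(_ j0)]; rewrite Hj eqxx.
Qed.

Lemma trFD x y : trF (x + y) = trF x + trF y.
Proof. by rewrite /trF -big_split; apply: eq_bigr => i _; rewrite frobDp. Qed.

Lemma zeta_trD (R : realType) x y :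
  zeta R p ^+ tr (x + y) = zeta R p ^+ tr x * zeta R p ^+ tr y.
Proof.
have z1 := zeta_unity R (prime_gt0 (dp_prime D)).
rewrite -exprD -(expr_mod _ z1) (@natr_eq_mod _ (tr x + tr y)) ?expr_mod //.
by rewrite natrD !trK trFD.
Qed.

Lemma zeta_tr0 (R : realType) : zeta R p ^+ tr 0 = 1.
Proof.
have z1 := zeta_unity R (prime_gt0 (dp_prime D)).
rewrite -(expr_mod _ z1) (@natr_eq_mod _ 0) ?mod0n //.
rewrite trK /trF big1 // => i _; rewrite expr0n.
by rewrite -(prednK (prime_gt0 (dp_prime D))) eqn0Ngt expn_gt0.
Qed.

Lemma bsbE mu y : (bs mu * bb y)%g = (-1) ^+ mu *: mat2 1 y 0 1 :> 'M[F]_2.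
Proof. by rewrite /= mul_scalar_mx. Qed.

Lemma cent_bb mu eps g : g \in 'C[(bs mu * bbe eps)%g]%g ->
  [/\ g 1 0 = 0, g 1 1 = g 0 0 & (g 0 0 == 1) || (g 0 0 == -1)].
Proof.
move=> /cent1P; rewrite /commute => E.
have y0 : e ^+ eps != 0 by rewrite expf_neq0 ?e_neq0.
have {}E : (g * bbe eps = bbe eps * g)%g.
  apply: val_inj; have := congr1 (@sl2_mx F) E.
  rewrite [LHS]/= [RHS]/= [in LHS]mul_scalar_mx [in RHS]mul_scalar_mx.
  have s0 : (-1) ^+ mu != 0 :> F by rewrite signr_eq0.
  by rewrite -scalemxAl -scalemxAr => /(scalerI s0).
have g10 : g 1 0 = 0.
  have := congr1 (fun x : sl2 F => x 0 0) E; rewrite !sl2_M !mxE /= !mulr1 mulr0 mul1r addr0.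
  by rewrite -[LHS]addr0 => /addrI/esym/eqP; rewrite mulf_eq0 (negbTE y0) => /eqP.
have g11 : g 1 1 = g 0 0.
  have := congr1 (fun x : sl2 F => x 0 1) E; rewrite !sl2_M !mxE /= mulr1 mul1r addrC.
  by move/addrI; rewrite mulrC => /(mulfI y0).
split=> //; rewrite -sqrf_eq1 expr2 -{2}g11; apply/eqP.
by have := sl2_detE g; rewrite g10 mulr0 subr0.
Qed.

Section Characters.

Variable R : realType.

Local Notation C := R[i].

(* The characters u^*, (nu, v)^* and w^*, as representations of degree 1 of the
   centralizers; their values are given by chiAE, chiBE and chiCE.  In chiB, the
   element g = eta b(c) has g 0 0 = eta and g 0 0 * g 0 1 = c. *)
Definition chiA (u : nat) (g : sl2 F) : 'M[C]_1 := (zeta R q.-1 ^+ u ^+ dlog ba g)%:M.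

Definition chiB (nu : bool) (v : F) (g : sl2 F) : 'M[C]_1 :=
  (((-1) ^+ (g 0 0 != 1)%R) ^+ nu * zeta R p ^+ tr (v * (g 0 0 * g 0 1)))%:M.

Definition chiC (w : nat) (g : sl2 F) : 'M[C]_1 := (zeta R q.+1 ^+ w ^+ dlog bc g)%:M.

Lemma zetaA u : (zeta R q.-1 ^+ u) ^+ #[ba]%g = 1.
Proof.
have: e ^+ #[ba]%g = 1.
  by have := congr1 (fun x : sl2 F => x 0 0) (expg_order ba); rewrite /= baX !mxE.
move/eqP; rewrite -(prim_order_dvd e_prim) => /dvdnP[m ->].
have q0 : (0 < q.-1)%N by rewrite qE /= muln_gt0 h_gt0.
by rewrite -exprM mulnA mulnC exprM (zeta_unity R q0) expr1n.
Qed.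

Lemma zetaC w : (zeta R q.+1 ^+ w) ^+ #[bc]%g = 1.
Proof.
have: f ^+ #[bc]%g = 1 by rewrite -lam_cX expg_order lam1.
move/eqP; rewrite -(prim_order_dvd f_prim) => /dvdnP[m ->].
by rewrite -exprM mulnA mulnC exprM (zeta_unity R (ltn0Sn q)) expr1n.
Qed.

Fact chiA_repr k (hk : (1 <= k <= 2 * h - 1)%N) u :
  mx_repr 'C[(ba ^+ k)%g]%g (chiA u).
Proof. by apply: cyc_repr (zetaA u) _; rewrite cent_ba. Qed.

Fact chiC_repr l (hl : (1 <= l <= 2 * h)%N) w :
  mx_repr 'C[(bc ^+ l)%g]%g (chiC w).
Proof. by apply: cyc_repr (zetaC w) _; rewrite cent_bc. Qed.

Fact chiB_repr mu eps nu v : mx_repr 'C[(bs mu * bbe eps)%g]%g (chiB nu v).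
Proof.
split=> [|g g' Cg Cg'].
  by rewrite /chiB !sl2_1 !mulr0 zeta_tr0 mulr1 !eqxx expr1n.
have [g10 g11 gs] := cent_bb Cg; have [g10' g11' gs'] := cent_bb Cg'.
rewrite /chiB -scalar_mxM; congr (_%:M); rewrite !sl2_M g10' mulr0 addr0 g11'.
have sq : g 0 0 * g 0 0 = 1 by case/orP: gs => /eqP ->; rewrite ?mulrNN mulr1.
have sq' : g' 0 0 * g' 0 0 = 1 by case/orP: gs' => /eqP ->; rewrite ?mulrNN mulr1.
have -> : v * (g 0 0 * g' 0 0 * (g 0 0 * g' 0 1 + g 0 1 * g' 0 0)) =
   v * (g 0 0 * g 0 1) * (g' 0 0 * g' 0 0) + (g 0 0 * g 0 0) * (v * (g' 0 0 * g' 0 1)).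
  by ring.
rewrite sq sq' mulr1 mul1r zeta_trD mulrACA; congr (_ * _).
rewrite -exprMn; congr (_ ^+ _); rewrite -signr_addb; congr (_ ^+ _).
case/orP: gs => /eqP ->; case/orP: gs' => /eqP ->;
  by rewrite ?mulrNN ?mulr1 ?mul1r ?eqxx ?(negbTE F_Nneq1).
Qed.

Definition repA k hk u := MxRepresentation (@chiA_repr k hk u).
Definition repB mu eps nu v := MxRepresentation (chiB_repr mu eps nu v).
Definition repC l hl w := MxRepresentation (@chiC_repr l hl w).

Lemma chiAE u i : chiA u (ba ^+ i)%g = (zeta R q.-1 ^+ (i * u))%:M.
Proof. by rewrite /chiA dlogX ?zetaA // -exprM mulnC. Qed.

Lemma chiCE w i : chiC w (bc ^+ i)%g = (zeta R q.+1 ^+ (i * w))%:M.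
Proof. by rewrite /chiC dlogX ?zetaC // -exprM mulnC. Qed.

Lemma chiBE nu v eta c : chiB nu v (bs eta * bb c)%g =
  (((-1) ^+ eta) ^+ nu * zeta R p ^+ tr (v * c))%:M.
Proof.
rewrite /chiB bsbE !mxE /= mulr1; congr (_ ^+ _ * zeta R p ^+ tr (v * _))%:M.
  by case: eta; rewrite ?expr1 ?F_Nneq1 ?eqxx.
by rewrite mulrA -expr2 sqrr_sign mul1r.
Qed.

(* The labels of A_k^u, B_(mu, eps)^(nu, v) and C_l^w; the object U(x, rho) with
   label L has x = lpt L and rho = lrep L, and bs true is - 1. *)
Inductive label : Type :=
| LA (k : nat) of (1 <= k <= 2 * h - 1)%N & 'Z_(q.-1)
| LB (mu eps nu : bool) of F
| LC (l : nat) of (1 <= l <= 2 * h)%N & 'Z_(q.+1).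

Definition lpt (L : label) : sl2 F :=
  match L with
  | LA k _ _ => (ba ^+ k)%g
  | LB mu eps _ _ => (bs mu * bbe eps)%g
  | LC l _ _ => (bc ^+ l)%g
  end.

Definition lrep (L : label) : mx_representation C 'C[lpt L]%g 1 :=
  match L with
  | LA k hk u => repA hk u
  | LB mu eps nu v => repB mu eps nu v
  | LC l hl w => repC hl w
  end.

Definition lobj (L : label) : dobject C (sl2 F) := dsimple (lrep L).

Definition is_even (L : label) : bool := lrep L (bs true) == 1%:M.
Definition is_odd (L : label) : bool := lrep L (bs true) == (-1)%:M.

(* true, that is the sign -, when the parities of L1 and L2 differ *)
Definition nu_of (L1 L2 : label) : bool :=
  ~~ ((is_even L1 && is_even L2) || (is_odd L1 && is_odd L2)).

(* The element a_j attached to the simple object X_j. *)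
Definition lval (L : label) : K :=
  match L with
  | LA k _ _ => iota e ^+ k
  | LB mu _ _ _ => (-1) ^+ mu
  | LC l _ _ => f ^+ l
  end.

Definition isB (L : label) : bool := if L is LB _ _ _ _ then true else false.

End Characters.

End SL2q.

(* Main.v *)
Require Import Defs.
From HB Require Import structures.
From mathcomp Require Import all_boot all_order all_fingroup all_algebra.
From mathcomp Require Import all_solvable all_field all_character.
From mathcomp Require Import reals trigo complex ring lra zify.

(** The component X_(a^k) has a basis of tensors indexed by the pairs (g, g^-1 a^k)
with g in the class of X_1 and g^-1 a^k in the class of X_2.  The traces of g and
of g^-1 a^k determine the diagonal (x, w) of g, and the hypothesis on e^k says
exactly that x w <> 1, so that g is determined by y = g_(01) <> 0.  Conjugation by
a multiplies y by e^2; hence <a> / {1, -1} permutes the pairs freely, with one orbit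
per square class of y.  Membership in an A or C class puts no condition on y beyond
the trace, membership in a B class prescribes the square class of y, and passing
from g to g^-1 a^k changes that class by the parity of k.  Each orbit contributes
the representation of <a> induced from the sign of -1, that is the sum of the
characters u^* with u of the right parity. *)

Set Implicit Arguments.
Unset Strict Implicit.
Unset Printing Implicit Defensive.

Import Order.TTheory GRing.Theory Num.Theory.
Local Open Scope ring_scope.

(** * Objects of E(Gamma) and their morphisms *)

Section GradedObjects.

Variables (C : fieldType) (gT : finGroupType).
Implicit Types (U V W X Y : dobject C gT) (x y g : gT).

Lemma dact_inj Y g : injective (dact Y g).
Proof.
apply: (can_inj (g := dact Y g^-1%g)) => u.
by rewrite -comp_lfunE -dactM mulVg dact1 id_lfunE.
Qed.

Lemma dact_img_stable W Y (f : 'Hom(W, Y)) g v :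
  dmorphism f -> v \in limg f -> dact Y g v \in limg f.
Proof.
case=> _ fL /memv_imgP[w _ ->]; rewrite -comp_lfunE -fL comp_lfunE.
by rewrite memv_img ?memvf.
Qed.

Lemma dmorphism0 W Y : dmorphism (0 : 'Hom(W, Y)).
Proof.
split=> [x|g].
  by rewrite lim0g sub0v.
by rewrite comp_lfun0l comp_lfun0r.
Qed.

Section SumMorphism.

Variables (U V Y : dobject C gT) (f : 'Hom(U, Y)) (g : 'Hom(V, Y)).
Hypotheses (fP : dmorphism f) (gP : dmorphism g).

Definition dsum_hom_fun (w : dsum U V) : Y := f w.1 + g w.2.

Fact dsum_hom_linear : linear dsum_hom_fun.
Proof. by move=> a u v; rewrite /dsum_hom_fun !linearP scalerDr addrACA. Qed.

HB.instance Definition _ :=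
  GRing.isLinear.Build C (dsum U V) Y _ dsum_hom_fun dsum_hom_linear.

Definition dsum_hom : 'Hom(dsum U V, Y) := linfun dsum_hom_fun.

Lemma dsum_hom_morphism : dmorphism dsum_hom.
Proof.
case: fP gP => fG fL [gG gL]; split=> [x|z].
  apply/subvP=> _ /memv_imgP[w wx ->]; rewrite lfunE /=.
  move: wx; rewrite mem_sum_gr => /andP[w1 w2].
  by apply: memvD; [apply: (subvP (fG x)) | apply: (subvP (gG x))]; rewrite memv_img.
apply/lfunP=> w; rewrite !comp_lfunE !lfunE /= /dsum_hom_fun /=. 
rewrite linearD /=; congr (_ + _).
  by rewrite -comp_lfunE fL comp_lfunE.
by rewrite -comp_lfunE gL comp_lfunE.
Qed.

Lemma limg_dsum_hom : (limg f + limg g <= limg dsum_hom)%VS.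
Proof.
apply/subvP=> _ /memv_addP[_ /memv_imgP[u _ ->] [_ /memv_imgP[v _ ->] ->]].
have -> : f u + g v = dsum_hom (u, v) by rewrite lfunE.
by rewrite memv_img ?memvf.
Qed.

End SumMorphism.

(** Only surjectivity is tracked, since it passes to direct sums without any independence check;
    injectivity comes from the dimension count in [dsupp_iso]. *)
Definition covers Y W (A : {vspace Y}) : Prop :=
  exists2 f : 'Hom(W, Y), dmorphism f & (A <= limg f)%VS.

Lemma covers0 Y : covers (dzero C gT) (0%VS : {vspace Y}).
Proof. by exists 0; [exact: dmorphism0 | exact: sub0v]. Qed.

Lemma covers_dsum Y U V (A B : {vspace Y}) :
  covers U A -> covers V B -> covers (dsum U V) (A + B)%VS.
Proof.
move=> [f fP Af] [g gP Bg]; exists (dsum_hom f g); first exact: dsum_hom_morphism.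
by apply: subv_trans (addvS Af Bg) (limg_dsum_hom f g).
Qed.

Lemma covers_big Y I (r : seq I) (P : pred I) (W : I -> dobject C gT)
    (A : I -> {vspace Y}) :
  (forall i, P i -> covers (W i) (A i)) ->
  covers (\big[@dsum C gT/dzero C gT]_(i <- r | P i) W i) (\sum_(i <- r | P i) A i)%VS.
Proof.
move=> WA; elim/big_rec2: _ => [|i A' W' Pi IH]; first exact: covers0.
exact: covers_dsum (WA i Pi) IH.
Qed.

Lemma dim_dzero : dim (dzero C gT) = 0%N.
Proof. by []. Qed.

Lemma dim_dsum U V : dim (dsum U V) = (dim U + dim V)%N.
Proof. by []. Qed.

Lemma dim_big_dsum I (r : seq I) (P : pred I) (W : I -> dobject C gT) :
  dim (\big[@dsum C gT/dzero C gT]_(i <- r | P i) W i)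
    = (\sum_(i <- r | P i) dim (W i))%N.
Proof. by elim/big_rec2: _ => //= i m U _ <-. Qed.

Lemma dim_dgrJ Y g x : \dim (dgr Y (g * x * g^-1)%g) = \dim (dgr Y x).
Proof.
rewrite -dact_gr limg_dim_eq //.
have /lker0P/eqP -> : injective (dact Y g) := @dact_inj Y g.
by rewrite capv0.
Qed.

Lemma dim_supp_vs Y x :
  \dim (supp_vs Y x) = (#|x ^: [set: gT]|%g * \dim (dgr Y x))%N.
Proof.
have dir : directv (\sum_(y in (x ^: [set: gT])%g) dgr Y y).
  apply/directv_sum_independent=> us usP us0 y yx.
  pose vs z := if z \in (x ^: [set: gT])%g then us z else 0.
  have vs0 : \sum_z vs z = 0 by rewrite -big_mkcond.
  have vsP z : vs z \in dgr Y z.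
    by rewrite /vs; case: ifP => [/usP|] //; rewrite mem0v.
  by have := gr_indep vsP vs0 y; rewrite /vs yx.
rewrite /supp_vs (directvP dir) /= -sum_nat_const; apply: eq_bigr => y.
case/imsetP=> g _ ->; rewrite -[RHS](dim_dgrJ Y g^-1).
by rewrite conjgE invgK mulgA.
Qed.

(** The image of a morphism is stable under the action, which carries the piece at x onto the piece
    at each conjugate. *)
Lemma supp_vs_sub_limg Y x W (f : 'Hom(W, Y)) :
  dmorphism f -> (dgr Y x <= limg f)%VS -> (supp_vs Y x <= limg f)%VS.
Proof.
move=> fP fx; apply/subv_sumP=> y /imsetP[g _ ->].
have -> : (x ^ g = g^-1 * x * g^-1^-1)%g by rewrite conjgE invgK mulgA.
rewrite -dact_gr; apply/subvP=> _ /memv_imgP[v vx ->].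
by apply: dact_img_stable fP _; apply: (subvP fx).
Qed.

Section SuppIso.

Variables (Y : dobject C gT) (x : gT) (W : dobject C gT) (f : 'Hom(W, Y)).
Hypotheses (fP : dmorphism f) (sf : (supp_vs Y x <= limg f)%VS).
Hypothesis dW : (dim W <= \dim (supp_vs Y x))%N.

(** By rank and nullity the two bounds force f to be injective with image exactly the supported
    part. *)
Lemma dsupp_iso : diso (dsupp Y x) W.
Proof.
have dimf : (\dim {:W} + 0 = \dim (lker f) + \dim (limg f))%N.
  by have := limg_ker_dim f fullv; rewrite capfv addn0 => ->.
have dker : \dim (lker f) = 0%N.
  by have := dimvS sf; move: dimf dW; rewrite dimvf; lia.
have /eqP ker0 : lker f == 0%VS by rewrite -dimv_eq0 dker.
have Ef : limg f = supp_vs Y x.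
  apply/eqP; rewrite eq_sym eqEdim sf /=.
  by move: dimf dW; rewrite dimvf dker; lia.
have finj : lker f == 0%VS by rewrite ker0.
have [fG fL] := fP.
pose vs := linfun (vsval : subvs_of (supp_vs Y x) -> Y).
pose ps := linfun (vsproj (supp_vs Y x)).
pose F : 'Hom(dsupp Y x, W) := (f^-1 \o vs)%VF.
pose G : 'Hom(W, dsupp Y x) := (ps \o f)%VF.
have GE w : vsval (G w : subvs_of _) = f w.
  by rewrite comp_lfunE lfunE /= vsprojK // -Ef memv_img ?memvf.
have FG : (F \o G)%VF = \1%VF.
  apply/lfunP=> w; rewrite comp_lfunE [F _]comp_lfunE lfunE /= GE.
  by rewrite lker0_lfunK // id_lfunE.
have fF v : f (F v) = vsval v.
  by rewrite comp_lfunE lfunE /= limg_lfunVK // Ef subvsP.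
have GF : (G \o F)%VF = \1%VF.
  apply/lfunP=> v; apply: (val_inj : injective vsval).
  by rewrite comp_lfunE id_lfunE GE fF.
have GP : dmorphism G.
  split=> [y|g].
    apply/subvP=> _ /memv_imgP[w wy ->]; rewrite mem_supp_gr GE.
    by apply: (subvP (fG y)); rewrite memv_img.
  apply/lfunP=> w; apply: (val_inj : injective vsval).
  have EL u : vsval (dact (dsupp Y x) g u : subvs_of _) = dact Y g (vsval u).
    exact: supp_actE.
  rewrite (comp_lfunE (dact _ _)) (comp_lfunE G) GE EL GE.
  by rewrite -(comp_lfunE f) fL comp_lfunE.
exists F, G; split=> //; case: GP => GG GL; split=> [y|g]; last first.
  apply/lfunP=> v; rewrite !(comp_lfunE F) (comp_lfunE _ F).
  rewrite -[in LHS](id_lfunE v) -GF comp_lfunE -(comp_lfunE _ G) -GL comp_lfunE.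
  by rewrite -(comp_lfunE F) FG id_lfunE.
apply/subvP=> _ /memv_imgP[v vy ->].
have : F v \in fullv by rewrite memvf.
rewrite -(dgr_full W) => /memv_sumP[ws wsP Ew].
have Ev : v = \sum_z G (ws z).
  by rewrite -[LHS]id_lfunE -GF comp_lfunE Ew linear_sum.
(* v is homogeneous of degree y and is also the sum of the [G (ws z)]; uniqueness of components
   kills [ws z] for z other than y, so [F] respects the grading. *)
pose us z := G (ws z) - (if z == y then v else 0).
have us0 z : us z = 0.
  apply: gr_indep z => [z|].
    rewrite memvB //; first by apply: (subvP (GG z)); rewrite memv_img ?wsP.
    by case: eqP => [->|_]; rewrite ?mem0v.
  by rewrite sumrB -Ev -big_mkcond big_pred1_eq subrr.
have Fws z : z != y -> ws z = 0.
  move=> /negbTE zy; have := us0 z; rewrite /us zy subr0 => Gw.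
  by rewrite -[ws z]id_lfunE -FG comp_lfunE Gw linear0.
rewrite Ew (bigD1 y) //= big1 ?addr0 ?wsP //.
Qed.

End SuppIso.

Lemma diso_dzero_dim X : diso X (dzero C gT) -> dim X = 0%N.
Proof.
move=> [f [g [_ _ gf _]]]; apply/eqP.
rewrite -(dimvf X) dimv_eq0 -subv0; apply/subvP=> v _.
by rewrite memv0 -[v]id_lfunE -gf comp_lfunE [f v]thinmx0 linear0.
Qed.

Lemma dim_dsupp X x : dim (dsupp X x) = \dim (supp_vs X x).
Proof. by []. Qed.

Section SimpleMorphism.

Variables (x : gT) (rho : mx_representation C 'C[x]%g 1).
Variables (Y : dobject C gT) (v : Y).
Hypothesis vx : v \in dgr Y x.
Hypothesis vL : forall b, b \in 'C[x]%g -> dact Y b v = rho b 0 0 *: v.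

(** Frobenius reciprocity: U(x, rho) is induced from the centralizer of x, so a vector of degree x
    on which the centralizer acts by rho determines a morphism. *)
Definition simple_hom_fun (phi : dsimple rho) : Y :=
  \sum_(z : cls x) (phi : {ffun cls x -> 'cV[C]_1}) z 0 0 *: dact Y (crep x (val z)) v.

Fact simple_hom_linear : linear simple_hom_fun.
Proof.
move=> a u w; rewrite /simple_hom_fun scaler_sumr -big_split; apply: eq_bigr => z _ /=.
by rewrite !ffunE !mxE scalerDl scalerA.
Qed.

HB.instance Definition _ :=
  GRing.isLinear.Build C (dsimple rho) Y _ simple_hom_fun simple_hom_linear.

Definition simple_hom : 'Hom(dsimple rho, Y) := linfun simple_hom_fun.

Lemma clsJ_inj g : injective (@clsJ gT x g).
Proof.
move=> y z /(congr1 val) /= /mulIg /mulgI; exact: val_inj.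
Qed.

Lemma simple_hom_morphism : dmorphism simple_hom.
Proof.
split=> [y|g].
  apply/subvP=> _ /memv_imgP[phi /mem_simple_gr phiy ->]; rewrite lfunE /=.
  apply: memv_suml => z _; have [<-|zy] := eqVneq (val z) y; last first.
    by rewrite phiy // mxE scale0r mem0v.
  by rewrite memvZ // -[in dgr Y _](crepP z) -dact_gr memv_img.
apply/lfunP=> phi; rewrite !comp_lfunE !lfunE /= /simple_hom_fun /=.
(* The sums match termwise: g times the representative of g^-1 z g is the representative of z times
   [shift g z], which acts on v through rho. *)
rewrite linear_sum [RHS](reindex_inj (@clsJ_inj g)); apply: eq_bigr => z _.
rewrite linearZ /= -comp_lfunE -dactM !ffunE mxE big_ord1 mulrC -scalerA; congr (_ *: _).
rewrite -linearZ -vL ?shift_cent //= -comp_lfunE -dactM; congr (dact Y _ v).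
by rewrite /shift /= !mulgA mulgV mul1g.
Qed.

(** The family concentrated at x maps to the translate of v by [crep x x], which may differ from 1;
    stability of the image under the action undoes the translation. *)
Lemma mem_limg_simple_hom : v \in limg simple_hom.
Proof.
pose z0 : cls x := Sub x (class_refl [set: gT] x).
have : simple_hom [ffun z => (z == z0)%:R] = dact Y (crep x x) v.
  rewrite lfunE /= /simple_hom_fun (bigD1 z0) //= big1 ?addr0.
    by rewrite ffunE eqxx mxE scale1r.
  by move=> z /negbTE zz; rewrite ffunE zz mxE scale0r.
move=> E; rewrite -[v]id_lfunE -(dact1 Y) -(mulVg (crep x x)) dactM comp_lfunE -E.
by apply: dact_img_stable simple_hom_morphism _; rewrite memv_img ?memvf.
Qed.

Lemma covers_dsimple : covers (dsimple rho) <[v]>%VS.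
Proof.
exists simple_hom; first exact: simple_hom_morphism.
by rewrite -memvE mem_limg_simple_hom.
Qed.

End SimpleMorphism.

Lemma dim_dsimple x n (rho : mx_representation C 'C[x]%g n) :
  dim (dsimple rho) = (#|x ^: [set: gT]|%g * n)%N.
Proof.
by rewrite -card_sig -[n in RHS]muln1.
Qed.

End GradedObjects.

(** * Graded pieces of tensor products and of simple objects *)

Section TensorDimension.

Variables (C : fieldType) (gT : finGroupType) (U V : dobject C gT).

Lemma sum_dim_dgr (Y : dobject C gT) : (\sum_x \dim (dgr Y x))%N = dim Y.
Proof. by have /= <- := directvP (dgr_direct Y); rewrite dgr_full dimvf. Qed.

(** Each piece has at most this dimension, and both sides sum over z to dim U times dim V, so every
    inequality is an equality. *)
Lemma dim_dtensor_gr z : \dim (dgr (dtensor U V) z) =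
  (\sum_(p : gT * gT | (p.1 * p.2)%g == z) \dim (dgr U p.1) * \dim (dgr V p.2))%N.
Proof.
pose b z := (\sum_(p : gT * gT | (p.1 * p.2)%g == z)
  \dim (dgr U p.1) * \dim (dgr V p.2))%N.
have le x : (\dim (dgr (dtensor U V) x) <= b x)%N.
  by rewrite (leq_trans (dimv_leq_sum _ _ _)) // leq_sum // => p _; apply: dim_tens_vs.
have sb : (\sum_x b x = dim U * dim V)%N.
  have <- : (\sum_(p : gT * gT) \dim (dgr U p.1) * \dim (dgr V p.2) = \sum_x b x)%N.
    by rewrite (partition_big (fun p : gT * gT => (p.1 * p.2)%g) predT).
  rewrite -(pair_bigA _ (fun x y => (\dim (dgr U x) * \dim (dgr V y))%N)) /=.
  rewrite (eq_bigr (fun x => \dim (dgr U x) * dim V)%N); last first.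
    by move=> x _; rewrite -big_distrr /= sum_dim_dgr.
  by rewrite -big_distrl /= sum_dim_dgr.
have := leqif_sum (fun x (_ : true) => leqif_eq (le x)).
rewrite sb sum_dim_dgr => -[_].
have -> : dim (dtensor U V) = (dim U * dim V)%N.
  by rewrite -(dimvf U) -(dimvf V).
by rewrite eqxx => /esym/forallP/(_ z)/eqP.
Qed.

End TensorDimension.

Section DeltaVector.

Variables (C : fieldType) (gT : finGroupType) (x : gT).
Variable rho : mx_representation C 'C[x]%g 1.

(** Taking y in the whole group makes the vector zero off the class, so that [dgr_dsimple] holds
    without a case distinction. *)
Definition dsimple_delta (y : gT) : dsimple rho :=
  [ffun z : cls x => (val z == y)%:R%:M : 'cV[C]_1].

Lemma dgr_dsimple y : dgr (dsimple rho) y = <[dsimple_delta y]>%VS.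
Proof.
apply/eqP; rewrite eqEsubv; apply/andP; split; apply/subvP=> phi.
  move/mem_simple_gr=> phiy.
  have [yx|yx] := boolP (y \in (x ^: [set: gT])%g).
    apply/vlineP; exists ((phi : {ffun cls x -> 'cV[C]_1}) (Sub y yx) 0 0).
    apply/ffunP=> z; rewrite !ffunE; apply/matrixP=> i j; rewrite !mxE !ord1 eqxx.
    have [zy|zy] := eqVneq (val z) y; last by rewrite phiy // mxE mulr0.
    by rewrite mulr1; congr (phi _ _ _); apply: val_inj.
  rewrite (_ : phi = 0) ?mem0v //; apply/ffunP=> z; rewrite phiy ?ffunE //.
  by apply: contraNneq yx => <-; apply: valP.
case/vlineP=> a ->; rewrite memvZ //; apply/mem_simple_gr=> z /negbTE zy.
by rewrite ffunE zy; apply/matrixP=> i j; rewrite !mxE mul0rn.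
Qed.

Lemma dim_dgr_dsimple y :
  \dim (dgr (dsimple rho) y) = (y \in (x ^: [set: gT])%g).
Proof.
rewrite dgr_dsimple dim_vline; congr (nat_of_bool _).
apply/idP/idP => [|yx]; last first.
  apply/eqP=> /ffunP/(_ (Sub y yx))/matrixP/(_ 0 0).
  by rewrite !ffunE !mxE !eqxx => /eqP; rewrite oner_eq0.
apply: contraNT => yx; apply/eqP/ffunP=> z; rewrite !ffunE.
case: eqP => [zy|_]; first by rewrite -zy (valP z) in yx.
by apply/matrixP=> i j; rewrite !mxE mul0rn.
Qed.

Lemma dsimple_delta_eq0 y : y \notin (x ^: [set: gT])%g -> dsimple_delta y = 0.
Proof.
move=> yx; apply/eqP; rewrite -memv0.
have : \dim (dgr (dsimple rho) y) = 0%N by rewrite dim_dgr_dsimple (negbTE yx).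
by move/eqP; rewrite dimv_eq0 dgr_dsimple => /eqP <-; rewrite memv_line.
Qed.

Lemma dact_dsimple_central g : (forall y, commute g y) ->
  dact (dsimple rho) g = (rho g 0 0) *: \1%VF.
Proof.
move=> gC; apply/lfunP=> phi; rewrite lfunE /= !lfunE /=.
apply/ffunP=> z; rewrite !ffunE.
have Ez : clsJ g z = z.
  by apply: val_inj; rewrite /= -mulgA -gC mulgA mulVg mul1g.
have -> : shift g z = g by rewrite /shift Ez -mulgA gC mulgA mulVg mul1g.
rewrite Ez; apply/matrixP=> i j; rewrite !mxE big_ord1.
by rewrite id_lfunE !ord1.
Qed.

End DeltaVector.

(** * Eigenspace projections and roots of unity *)

Section Eigenvectors.

Variables (C : fieldType) (gT : finGroupType) (Y : dobject C gT) (g : gT) (N : nat).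
Hypothesis gN : (g ^+ N)%g = 1%g.

(* The projection of w onto the xi-eigenspace of g, up to the factor N. *)
Definition eigvec (xi : C) (w : Y) : Y := \sum_(i < N) xi^-1 ^+ i *: dact Y (g ^+ i)%g w.

Lemma eigvec_act xi w : xi ^+ N = 1 -> dact Y g (eigvec xi w) = xi *: eigvec xi w.
Proof.
move=> xiN; pose F i := xi^-1 ^+ i *: dact Y (g ^+ i)%g w.
have [N0|N0] := posnP N; first by rewrite /eigvec N0 !big_ord0 linear0 scaler0.
have xi0 : xi != 0.
  by move: xiN; apply: contra_eq_neq => ->; rewrite expr0n gtn_eqF // eq_sym oner_eq0.
(* A cyclic shift of the summation: the terms of index 0 and N agree because g and xi both have
   trivial N-th power. *)
have FE : \sum_(i < N) F i.+1 = \sum_(i < N) F i.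
  apply: (addrI (F 0%N)); rewrite -(big_ord_recl N (fun i => F (nat_of_ord i))).
  rewrite big_ord_recr /= addrC.
  by congr (_ + _); rewrite /F gN exprVn xiN invr1 expg0.
change (dact Y g (\sum_(i < N) F i) = xi *: \sum_(i < N) F i).
rewrite -[in RHS]FE linear_sum scaler_sumr.
apply: eq_bigr => i _; rewrite linearZ /= -comp_lfunE -dactM -expgS.
by rewrite /F scalerA exprS mulrA mulfV // mul1r.
Qed.

Lemma eigvec_actX xi w j : xi ^+ N = 1 ->
  dact Y (g ^+ j)%g (eigvec xi w) = xi ^+ j *: eigvec xi w.
Proof.
move=> xiN; elim: j => [|j IH]; first by rewrite dact1 id_lfunE scale1r.
by rewrite expgSr dactM comp_lfunE eigvec_act // linearZ /= IH scalerA -exprS.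
Qed.

(** The projection is an eigenvector of g^m for both xi^m and c. This removes the characters of the
    wrong parity. *)
Lemma eigvec_eq0 xi w m c : xi ^+ N = 1 -> dact Y (g ^+ m)%g w = c *: w ->
  xi ^+ m != c -> eigvec xi w = 0.
Proof.
move=> xiN wm neq; apply/eqP.
have : (xi ^+ m - c) *: eigvec xi w = 0.
  rewrite scalerBl -eigvec_actX // linear_sum scaler_sumr -sumrB big1 // => i _.
  rewrite linearZ /= -comp_lfunE -dactM -expgD addnC expgD dactM comp_lfunE wm.
  by rewrite linearZ /= !scalerA mulrC subrr.
by move/eqP; rewrite scaler_eq0 subr_eq0 (negbTE neq).
Qed.

Lemma dgr_eigvec xi w x : commute g x -> w \in dgr Y x -> eigvec xi w \in dgr Y x.
Proof.
move=> gx wx; apply: memv_suml => i _; rewrite memvZ //.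
have gxi : commute x (g ^+ i)%g by apply: commuteX; apply: commute_sym.
have <- : (g ^+ i * x * (g ^+ i)^-1)%g = x by rewrite -gxi mulgK.
by rewrite -dact_gr memv_img.
Qed.

(** Orthogonality of characters: the coefficient of g^i w is N for i = 0 and a vanishing geometric
    sum otherwise. *)
Lemma sum_eigvec om w : (N.-primitive_root om) ->
  \sum_(1 <= u < N.+1) eigvec (om ^+ u) w = N%:R *: w.
Proof.
move=> omP; have N0 := prim_order_gt0 omP.
rewrite /eigvec exchange_big (bigD1 (Ordinal N0)) //= [X in _ + X]big1 => [|i i0].
  rewrite addr0 dact1 id_lfunE -scaler_suml; congr (_ *: _).
  by rewrite big_add1 /= big_mkord sumr_const card_ord.
rewrite -scaler_suml; apply/eqP; rewrite scaler_eq0; apply/orP; left.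
pose eta := om^-1 ^+ i.
have eta1 : eta != 1.
  rewrite /eta exprVn invr_eq1 -(prim_order_dvd omP); apply/negP.
  have : (0 < i)%N by rewrite lt0n; apply: contraNneq i0 => i0; apply/eqP/val_inj.
  by move=> i1 /(dvdn_leq i1); rewrite leqNgt ltn_ord.
have etaN : eta ^+ N = 1.
  by rewrite /eta !exprVn -exprM mulnC exprM (prim_expr_order omP) expr1n invr1.
rewrite (eq_bigr (fun u => eta ^+ u)); last first.
  by move=> u _; rewrite /eta -!exprVn -!exprM mulnC.
rewrite big_add1 /= big_mkord (eq_bigr (fun u : 'I_N => eta * eta ^+ u)); last first.
  by move=> u _; rewrite exprS.
rewrite -mulr_sumr mulf_eq0; apply/orP; right.
have := subrX1 eta N; rewrite etaN subrr => /esym/eqP.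
by rewrite mulf_eq0 subr_eq0 (negbTE eta1).
Qed.

End Eigenvectors.

(** If the order m were less than N, then t = m pi / N would lie strictly between 0 and pi while cos
    2t = 1, contradicting sin t > 0. *)
Lemma zeta_prim (R : realType) N : (0 < N)%N -> N.-primitive_root (zeta R N).
Proof.
move=> N0; have z1 := zeta_unity R N0.
have [m mP mN] := prim_order_exists N0 z1.
suff E : m = N by move: mP; rewrite E.
have m0 := prim_order_gt0 mP.
have {mP mN} : zeta R N ^+ m = 1 /\ (m <= N)%N.
  by rewrite (prim_expr_order mP) dvdn_leq.
case; have [->//|mN] := eqVneq m N; rewrite leq_eqVlt (negbTE mN) /= => zm lt.
exfalso; move: zm; rewrite zetaX => /eqP; rewrite eq_complex /= => /andP[/eqP c1 _].
pose t : R := m%:R * pi / N%:R.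
have NR : 0 < N%:R :> R by rewrite ltr0n.
have t0 : 0 < t by rewrite divr_gt0 // mulr_gt0 ?pi_gt0 // ltr0n.
have t1 : t < pi by rewrite ltr_pdivrMr // mulrC ltr_pM2l ?pi_gt0 // ltr_nat.
have := sin_gt0_pi; move/(_ R t); rewrite t0 t1 => /(_ isT) s0.
move: c1; have -> : m%:R * (2 * pi / N%:R) = t *+ 2 :> R by rewrite /t -mulr_natl; ring.
rewrite cos_mulr2n cos2sin2 => /eqP; rewrite subr_eq.
have : 0 < sin t ^+ 2 by rewrite exprn_gt0.
by move: (sin t ^+ 2) => s + /eqP; clear; rewrite mulr2n => s1 E; lra.
Qed.

(** * Conjugacy classes of SL(2, q) *)

Section SpecialLinear.

Variable F : finFieldType.
Implicit Types x g M : sl2 F.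

Lemma sl2_V g : [/\ g^-1%g 0 0 = g 1 1, g^-1%g 0 1 = - g 0 1,
  g^-1%g 1 0 = - g 1 0 & g^-1%g 1 1 = g 0 0].
Proof.
have det_adj : \det (mat2 (g 1 1) (- g 0 1) (- g 1 0) (g 0 0)) == 1.
  by rewrite det2E !mxE /= mulrNN mulrC -(sl2_detE g).
suff -> : g^-1%g = SL2 det_adj by rewrite !mxE.
apply: (mulgI g); rewrite mulgV; have dg := sl2_detE g.
by apply: sl2_eqP; rewrite sl2_1 sl2_M !mxE /= -?dg; ring.
Qed.

Definition tr2 g : F := g 0 0 + g 1 1.

Lemma tr2J x g : tr2 (x ^ g)%g = tr2 x.
Proof.
rewrite conjgE; have [V00 V01 V10 V11] := sl2_V g.
rewrite /tr2 !sl2_M V00 V01 V10 V11.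
transitivity ((x 0 0 + x 1 1) * (g 0 0 * g 1 1 - g 0 1 * g 1 0)); first by ring.
by rewrite sl2_detE mulr1.
Qed.

(* The upper right entry of g x g^-1, as a quadratic form in the first row of g;
   the square classes of its nonzero values tell apart the conjugacy classes of
   noncentral matrices with the same trace. *)
Definition qform x (r s : F) : F :=
  x 0 1 * r ^+ 2 + (x 1 1 - x 0 0) * (r * s) - x 1 0 * s ^+ 2.

Lemma conj01 x g : (g * x * g^-1)%g 0 1 = qform x (g 0 0) (g 0 1).
Proof.
have [V00 V01 V10 V11] := sl2_V g.
by rewrite /qform !sl2_M V01 V11; ring.
Qed.

Lemma ex_first_row (r s : F) : (r != 0) || (s != 0) -> exists g, g 0 0 = r /\ g 0 1 = s.
Proof.
have [r0|r0 /= s0] := eqVneq r 0; last first.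
  have d : \det (mat2 r s 0 r^-1) == 1 by rewrite det2E !mxE /= mulr0 subr0 mulfV.
  by exists (SL2 d); rewrite !mxE.
rewrite r0 /= => s0.
have d : \det (mat2 0 s (- s^-1) 0) == 1.
  by rewrite det2E !mxE /= mul0r sub0r mulrN opprK mulfV.
by exists (SL2 d); rewrite !mxE.
Qed.

(** Conjugation by a lower unitriangular matrix keeps the upper right entry and moves the upper left
    one by any multiple of it; trace and determinant then fix the rest. *)
Lemma conj_eq_tr_entry x M : tr2 M = tr2 x -> M 0 1 = x 0 1 -> x 0 1 != 0 ->
  M \in (x ^: [set: sl2 F])%g.
Proof.
move=> trM M01 x01.
pose c := (x 0 0 - M 0 0) / x 0 1.
have d : \det (mat2 1 0 c 1) == 1 by rewrite det2E !mxE /= mul0r subr0 mulr1.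
pose l : sl2 F := SL2 d.
have [V00 V01 V10 V11] := sl2_V l.
suff -> : M = (x ^ l^-1)%g by rewrite memJ_class ?inE.
rewrite conjgE invgK.
have E00 : (l * (x * l^-1))%g 0 0 = M 0 0.
  by rewrite !sl2_M V00 V10 !mxE /= /c; field.
have E01 : (l * (x * l^-1))%g 0 1 = M 0 1.
  by rewrite !sl2_M V01 V11 !mxE /= M01; ring.
have E11 : (l * (x * l^-1))%g 1 1 = M 1 1.
  apply: (addrI (M 0 0)); rewrite -{1}E00 -/(tr2 _) -[RHS]/(tr2 M) trM.
  by have := tr2J x l^-1%g; rewrite conjgE invgK.
have M0 : M 0 1 != 0 by rewrite M01.
apply: sl2_eqP => //; apply: (mulfI M0); apply/eqP.
rewrite -(inj_eq oppr_inj) -(inj_eq (addrI (M 0 0 * M 1 1))) sl2_detE.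
by rewrite -{1}E00 -{1}E01 -{1}E11 sl2_detE.
Qed.

(** Dividing (r, s) by t gives the first row of a conjugator that makes the upper right entries
    equal. *)
Lemma mem_class_qform x M r s t : tr2 M = tr2 x -> M 0 1 != 0 ->
  qform x r s = M 0 1 * t ^+ 2 -> t != 0 -> M \in (x ^: [set: sl2 F])%g.
Proof.
move=> trM M0 Q t0.
have rs : (r / t != 0) || (s / t != 0).
  rewrite !mulf_eq0 !invr_eq0 (negbTE t0) !orbF -negb_and.
  apply/negP=> /andP[/eqP r0 /eqP s0]; have : M 0 1 * t ^+ 2 != 0.
    by rewrite mulf_neq0 ?expf_neq0.
  by rewrite -Q /qform r0 s0 expr0n /= !mulr0 subr0 addr0 eqxx.
have [g [g00 g01]] := ex_first_row rs.
have E : (g * x * g^-1)%g = (x ^ g^-1)%g by rewrite conjgE invgK mulgA.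
have M01 : M 0 1 = (x ^ g^-1)%g 0 1.
  rewrite -E conj01 g00 g01; apply: (mulIf (expf_neq0 2 t0)).
  by rewrite -Q /qform; field.
have := @conj_eq_tr_entry (x ^ g^-1)%g M.
rewrite tr2J -M01 => /(_ trM erefl M0).
by rewrite classGidl ?inE.
Qed.

End SpecialLinear.

Lemma zeta_half (R : realType) m : (0 < m)%N -> zeta R (2 * m) ^+ m = -1.
Proof.
move=> m0; have zP : (2 * m).-primitive_root (zeta R (2 * m)).
  by apply: zeta_prim; rewrite muln_gt0.
have /eqP : (zeta R (2 * m) ^+ m) ^+ 2 = 1.
  by rewrite -exprM [(m * 2)%N]mulnC (prim_expr_order zP).
rewrite sqrf_eq1 => /orP[|/eqP //].
by rewrite -(prim_order_dvd zP) => /dvdn_leq; lia.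
Qed.

Lemma sum_inv_eq (K : fieldType) (x a : K) : x != 0 -> a != 0 ->
  x + x^-1 = a + a^-1 -> exists s : bool, x = a ^ ((-1) ^+ s : int).
Proof.
move=> x0 a0 E; have : (x - a) * (x - a^-1) = 0.
  transitivity (x * ((x + x^-1) - (a + a^-1))); first by field; rewrite x0 a0.
  by rewrite E subrr mulr0.
move/eqP; rewrite mulf_eq0 !subr_eq0 => /orP[/eqP ->|/eqP ->].
  by exists false.
by exists true.
Qed.

(** * Classes and parities of the labelled simple objects *)

Section LabelClasses.

Variable D : sl2_data.

Local Notation F := (dF D).
Local Notation K := (dK D).
Local Notation iota := (diota D).
Local Notation h := (dh D).
Local Notation q := (q D).
Local Notation e := (e D).
Local Notation te := (te D).
Local Notation f := (f D).
Local Notation ba := (ba D).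
Local Notation bc := (bc D).
Local Notation label := (label D).
Implicit Types (L : label) (M g : sl2 F) (y t : F).

Lemma e_half : e ^+ (2 * h) = -1.
Proof.
have /eqP : (e ^+ (2 * h)) ^+ 2 = 1.
  by rewrite -exprM -(prim_expr_order (e_prim D)) qE; congr (_ ^+ _); lia.
rewrite sqrf_eq1 => /orP[|/eqP //].
by rewrite -(prim_order_dvd (e_prim D)) qE => /dvdn_leq; have := h_gt0 D; lia.
Qed.

(** As q = 4h + 1, -1 is a square; hence signs never affect a square class. *)
Lemma e_quarter : (e ^+ h) ^+ 2 = -1.
Proof. by rewrite -e_half -exprM mulnC. Qed.

Lemma sqclass_exists y : y != 0 -> exists b : bool, exists j : nat, y = e ^+ (b + 2 * j).
Proof.
move=> /e_log[i ->]; exists (odd i), i./2.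
by rewrite mul2n odd_double_half.
Qed.

(** The order q - 1 of e is even, so the parity of an exponent of e is well defined. *)
Lemma sqclass_uniq (b b' : bool) t t' : t != 0 -> t' != 0 ->
  e ^+ b * t ^+ 2 = e ^+ b' * t' ^+ 2 -> b = b'.
Proof.
move=> /e_log[i ->] /e_log[j ->]; rewrite -!exprM -!exprD => /eqP.
rewrite (eq_prim_root_expr (e_prim D)) qE /= => /eqP /(congr1 odd).
rewrite !odd_mod; last 2 first.
- by rewrite oddM.
- by rewrite oddM.
by rewrite !oddD !oddM !andbF !addbF !oddb.
Qed.

(* Whether a matrix with upper right entry in e^b (F^* )^2 and the trace of lpt L
   is conjugate to lpt L; see mem_class_lpt. *)
Definition allowed L (b : bool) : bool := if L is LB _ eps _ _ then b == eps else true.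

Lemma lpt_LB mu eps nu v : [/\ lpt (@LB D mu eps nu v) 0 0 = (-1) ^+ mu,
  lpt (@LB D mu eps nu v) 0 1 = (-1) ^+ mu * e ^+ eps,
  lpt (@LB D mu eps nu v) 1 0 = 0 & lpt (@LB D mu eps nu v) 1 1 = (-1) ^+ mu].
Proof. by rewrite /lpt bsbE !mxE /= mulr0 mulr1. Qed.

Lemma e_diff_neq0 k : (1 <= k <= 2 * h - 1)%N -> e ^- k - e ^+ k != 0.
Proof.
move=> kh; rewrite subr_eq0 eq_sym -(inj_eq (mulIf (expf_neq0 k (e_neq0 D)))).
rewrite mulVf ?expf_neq0 ?e_neq0 // -exprD -(prim_order_dvd (e_prim D)) qE.
by apply/negP=> /dvdn_leq; have := kh; lia.
Qed.

Lemma bcX01_neq0 l : (1 <= l <= 2 * h)%N -> (bc ^+ l)%g 0 1 != 0.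
Proof.
move=> lh; have [F1 F2] := formC_cX D l; set d := (bc ^+ l)%g in F1 F2 *.
apply/eqP=> d01; have := sl2_detE d; rewrite F1 F2 d01 mulr0 mul0r subr0 => d2.
have /eqP : f ^+ (l * 2) = 1.
  rewrite exprM -lam_cX -/d /lam d01 rmorph0 mulr0 addr0 -rmorphXn /=.
  by rewrite expr2 d2 rmorph1.
by rewrite -(prim_order_dvd (f_prim D)) qE => /dvdn_leq; move: lh; lia.
Qed.

(** The form [qform] is a nonzero multiple of r s for A, of r^2 for B, and of r^2 - e s^2 for C. The
    first and the last represent both square classes, the middle one only the class of e^eps. *)
Lemma mem_class_lpt L M (b : bool) t : M 0 1 = e ^+ b * t ^+ 2 -> t != 0 ->
  (M \in (lpt L ^: [set: sl2 F])%g) = (tr2 M == tr2 (lpt L)) && allowed L b.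
Proof.
move=> M01 t0; have e0 := e_neq0 D.
have M0 : M 0 1 != 0 by rewrite M01 mulf_neq0 ?expf_neq0.
apply/idP/andP=> [|[/eqP trM]].
  case/imsetP=> g _ EM; split; first by rewrite EM tr2J.
  case: L EM => // mu eps nu v EM /=.
  have := conj01 (lpt (LB mu eps nu v)) g^-1%g.
  rewrite invgK -mulgA -conjgE -EM /qform.
  have [-> -> -> ->] := lpt_LB mu eps nu v.
  rewrite subrr !mul0r subr0 addr0 M01 => Eb; apply/eqP.
  (* The factor (e^h)^mu absorbs the sign mu, because e^h squares to -1. *)
  apply: (@sqclass_uniq _ _ t ((e ^+ h) ^+ mu * g^-1%g 0 0)) => //.
    apply: contraTneq M0 => E0; rewrite M01 Eb negbK.
    move/eqP: E0; rewrite mulf_eq0 !expf_eq0 (negbTE e0) !andbF /= => /eqP ->.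
    by rewrite expr0n /= mulr0.
  by rewrite Eb exprMn [_ ^+ mu ^+ 2]exprAC e_quarter; ring.
case: L trM => [k hk u|mu eps nu v|l hl w] trM /=.
- move=> _; apply: (@mem_class_qform _ _ _ 1 (e ^+ b / (e ^- k - e ^+ k)) t^-1) => //.
    rewrite M01 /qform /= baX !mxE /=.
    have := e_diff_neq0 hk; move: (e ^- k - e ^+ k) (e ^+ b) => a c a0.
    by field; rewrite a0 t0.
  by rewrite invr_neq0.
- move=> /eqP Eb; apply: (@mem_class_qform _ _ _ 1 0 ((e ^+ h) ^+ mu / t)) => //.
    have [E00 E01 E10 E11] := lpt_LB mu eps nu v.
    rewrite M01 /qform E00 E01 E10 E11 exprMn [_ ^+ mu ^+ 2]exprAC e_quarter Eb.
    by field.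
  by rewrite mulf_neq0 ?invr_eq0 ?expf_neq0.
move=> _; have d0 := bcX01_neq0 hl; have [F1 F2] := formC_cX D l.
set d := (bc ^+ l)%g in d0 F1 F2 trM *.
have [b0 [j Ed]] := sqclass_exists d0.
have [Eb|Eb] := eqVneq b b0.
  apply: (@mem_class_qform _ _ _ 1 0 (e ^+ j / t)) => //.
    by rewrite M01 /qform Ed Eb exprD exprMn -!exprM mulnC; field.
  by rewrite mulf_neq0 ?invr_eq0 ?expf_neq0.
(* At (0, 1) the form takes the value -e times its value at (1, 0), which lies in the other square
   class; e^h accounts for the sign. *)
apply: (@mem_class_qform _ _ _ 0 1 (e ^+ b0 * e ^+ j * e ^+ h / t)) => //.
  have Ee : e = e ^+ b * e ^+ b0.
    by rewrite -exprD; case: (b) (b0) Eb => [] [].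
  have Ej : e ^+ (b0 + 2 * j) = e ^+ b0 * (e ^+ j) ^+ 2 by rewrite exprD mulnC exprM.
  rewrite M01 /qform F1 {1}Ee Ed Ej.
  rewrite !exprMn e_quarter.
  by field.
by rewrite !mulf_neq0 ?invr_eq0 ?expf_neq0.
Qed.

Lemma lval_neq0 L : lval L != 0.
Proof.
case: L => [k _ _|mu *|l _ _] /=;
  by rewrite expf_neq0 ?fmorph_eq0 ?e_neq0 ?f_neq0 ?oppr_eq0 ?oner_eq0.
Qed.

Lemma tr2_lpt L : iota (tr2 (lpt L)) = lval L + (lval L)^-1.
Proof.
case: L => [k hk u|mu eps nu v|l hl w].
- by rewrite /= /tr2 baX !mxE /= rmorphD /= fmorphV rmorphXn.
- have [E00 _ _ E11] := lpt_LB mu eps nu v; rewrite /tr2 E00 E11 /=.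
  by rewrite rmorphD /= rmorphXn rmorphN1 -exprVn invrN1.
have [F1 F2] := formC_cX D l; rewrite /= -lam_cX; set d := (bc ^+ l)%g in F1 F2 *.
(* The second factor is the conjugate eigenvalue; the product of the two is det d = 1. *)
have E : (iota (d 0 0) + te * iota (d 0 1)) * (iota (d 0 0) - te * iota (d 0 1)) = 1.
  rewrite -(rmorph1 iota) -(sl2_detE d) F1 F2 rmorphB !rmorphM /= iota_e; ring.
have l0 : iota (d 0 0) + te * iota (d 0 1) != 0.
  by apply/eqP=> E0; move/eqP: E; rewrite E0 mul0r eq_sym oner_eq0.
rewrite /lam (_ : (_ + _)^-1 = iota (d 0 0) - te * iota (d 0 1)).
  by rewrite /tr2 F2 rmorphD /=; ring.
by apply: (mulfI l0); rewrite E mulfV.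
Qed.

(** The exponent of the sign by which -1 acts, as [lrep_bs] shows. *)
Definition lpar L : bool :=
  match L with
  | LA _ _ u => odd u
  | LB _ _ nu _ => nu
  | LC _ _ w => odd w
  end.

Lemma bs_central mu g : commute (bs D mu) g.
Proof. by apply: val_inj; rewrite /= scalar_mxC. Qed.

Lemma ba_half : (ba ^+ (2 * h))%g = bs D true.
Proof.
apply: val_inj; rewrite /= baX e_half invrN1.
by apply: mat2P; rewrite !mxE.
Qed.

Lemma bc_half : (bc ^+ (2 * h).+1)%g = bs D true.
Proof.
apply: lam_inj; [exact: formC_cX|by split; rewrite !mxE //= mulr0n mulr0|].
rewrite lam_cX /lam !mxE /= mulr0n rmorph0 mulr0 addr0 rmorphN1.
have /eqP : (f ^+ (2 * h).+1) ^+ 2 = 1.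
  by rewrite -exprM -(prim_expr_order (f_prim D)) qE; congr (_ ^+ _); lia.
rewrite sqrf_eq1 => /orP[|/eqP //].
by rewrite -(prim_order_dvd (f_prim D)) qE => /dvdn_leq; lia.
Qed.

Section Parity.

Variable R : realType.

(** The element -1 is a^(2h) and also c^(2h+1), half-way through each cyclic group, where the root
    of unity takes the value -1. *)
Lemma lrep_bs L : lrep R L (bs D true) = ((-1) ^+ lpar L)%:M.
Proof.
have zA : zeta R q.-1 ^+ (2 * h) = -1.
  rewrite qE /= (_ : 4 * h = 2 * (2 * h))%N; last by lia.
  by rewrite zeta_half ?muln_gt0 ?h_gt0.
have zC : zeta R q.+1 ^+ (2 * h).+1 = -1.
  by rewrite qE (_ : (4 * h).+2 = 2 * (2 * h).+1)%N ?zeta_half //; lia.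
case: L => [k hk u|mu eps nu v|l hl w] /=.
- by rewrite -ba_half chiAE exprM zA signr_odd.
- have -> : bs D true = (bs D true * bb 0)%g.
    by apply: sl2_eqP; rewrite bsbE !mxE /= ?mulr0 ?mulr1.
  by rewrite chiBE mulr0 zeta_tr0 mulr1.
by rewrite -bc_half chiCE exprM zC signr_odd.
Qed.

Lemma nu_ofE L1 L2 : nu_of R L1 L2 = lpar L1 (+) lpar L2.
Proof.
have E (a b : bool) : (((-1) ^+ a)%:M == ((-1) ^+ b)%:M :> 'M[R[i]]_1) = (a == b).
  have -> : (((-1) ^+ a)%:M == ((-1) ^+ b)%:M :> 'M[R[i]]_1)
      = ((-1) ^+ a == (-1) ^+ b :> R[i]).
    by apply/eqP/eqP=> [/matrixP/(_ 0 0)|-> //]; rewrite !mxE.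
  by case: a b => [] []; rewrite ?eqxx // ?expr0 ?expr1 ?[1 == _]eq_sym eqNr ?oner_eq0.
have E0 L : is_even R L = (lpar L == false).
  by rewrite /is_even lrep_bs -(E _ false) expr0.
have E1 L : is_odd R L = (lpar L == true).
  by rewrite /is_odd lrep_bs -(E _ true) expr1.
by rewrite /nu_of !E0 !E1; case: lpar; case: lpar.
Qed.

End Parity.

End LabelClasses.

Lemma mem_dgr_tens (C : fieldType) (gT : finGroupType) (U V : dobject C gT) x y u v :
  u \in dgr U x -> v \in dgr V y -> tens u v \in dgr (dtensor U V) (x * y)%g.
Proof.
move=> ux vy; rewrite memvE /= /tens_gr (bigD1 (x, y)) //=.
by apply: subv_trans (addvSl _ _); rewrite -memvE mem_tens_vs.
Qed.

(** * Pairs of conjugates with product a^k *)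

Section Pairs.

Variables (D : sl2_data) (k : nat).
Hypothesis hk : (1 <= k <= 2 * dh D - 1)%N.
Variables L1 L2 : label D.
Hypothesis hgen : forall s1 s2 : bool,
  diota D (e D) ^+ k != lval L1 ^ ((-1) ^+ s1 : int) * lval L2 ^ ((-1) ^+ s2 : int).

Local Notation F := (dF D).
Local Notation iota := (diota D).
Local Notation h := (dh D).
Local Notation e := (e D).
Local Notation ba := (ba D).
Local Notation cl1 := (lpt L1 ^: [set: sl2 F])%g.
Local Notation cl2 := (lpt L2 ^: [set: sl2 F])%g.

(* The diagonal of g is determined by tr g = tr lpt L1 and tr (g^-1 a^k) = tr lpt L2. *)
Definition diag0 : F := (tr2 (lpt L2) - e ^+ k * tr2 (lpt L1)) / (e ^- k - e ^+ k).
Definition diag1 : F := tr2 (lpt L1) - diag0.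

Lemma diag_tr : diag1 * e ^+ k + diag0 * e ^- k = tr2 (lpt L2).
Proof.
rewrite /diag1 mulrBl -addrA [- _ + _]addrC -mulrBr /diag0 mulfVK ?e_diff_neq0 //.
by ring.
Qed.

Lemma diag_uniq x y : x + y = tr2 (lpt L1) ->
  y * e ^+ k + x * e ^- k = tr2 (lpt L2) -> x = diag0 /\ y = diag1.
Proof.
move=> E1 E2; have Ex : x = diag0.
  rewrite /diag0 -E1 -E2; have := e_diff_neq0 hk; move: (e ^- k) (e ^+ k) => a b ab.
  by apply: (mulIf ab); rewrite mulfVK //; ring.
by split=> //; rewrite /diag1 -E1 Ex addrC addKr.
Qed.

(** Otherwise [diag0] and its inverse would sum to the trace of [lpt L1], so [diag0] would be a_1 or
    its inverse. Likewise e^k / [diag0] would be a_2 or its inverse, and the product e^k contradicts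
    the hypothesis. *)
Lemma diag_neq1 : diag0 * diag1 - 1 != 0.
Proof.
rewrite subr_eq0; apply/eqP=> d1; have ek0 : e ^+ k != 0 by rewrite expf_neq0 ?e_neq0.
have d0 : diag0 != 0.
  by apply/eqP=> E0; move/eqP: d1; rewrite E0 mul0r eq_sym oner_eq0.
have Ed1 : diag1 = diag0^-1 by apply: (mulfI d0); rewrite d1 mulfV.
have [s1 Es1] : exists s : bool, iota diag0 = lval L1 ^ ((-1) ^+ s : int).
  apply: sum_inv_eq; rewrite ?fmorph_eq0 ?lval_neq0 //.
  by rewrite -tr2_lpt -fmorphV -rmorphD -Ed1 /diag1 addrC subrK.
have [s2 Es2] : exists s : bool, iota (e ^+ k / diag0) = lval L2 ^ ((-1) ^+ s : int).
  apply: sum_inv_eq; rewrite ?fmorph_eq0 ?mulf_neq0 ?invr_eq0 ?lval_neq0 //.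
  rewrite -tr2_lpt -fmorphV -rmorphD -diag_tr Ed1.
  by rewrite [(_ / diag0)^-1]invf_div [diag0^-1 * _]mulrC.
have /negP := hgen s1 s2; apply; rewrite -Es1 -Es2 -rmorphM -rmorphXn.
by rewrite mulrC mulfVK.
Qed.

Lemma pair_entries g : g \in cl1 -> (g^-1 * ba ^+ k)%g \in cl2 ->
  [/\ g 0 0 = diag0, g 1 1 = diag1 & g 0 1 != 0].
Proof.
move=> /imsetP[u _ Eu] /imsetP[v _ Ev].
have [V00 V01 V10 V11] := sl2_V g.
have [E0 E1] : g 0 0 = diag0 /\ g 1 1 = diag1.
  apply: diag_uniq; first by rewrite -/(tr2 g) Eu tr2J.
  by rewrite -(tr2J _ v) -Ev /tr2 !sl2_M baX V00 V01 V10 V11 !mxE /= !mulr0 addr0 add0r.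
split=> //; have := diag_neq1; apply: contraNneq => g01.
by rewrite -E0 -E1 -(sl2_detE g) g01 mul0r subr0 subrr.
Qed.

(** The determinant is 1 for y nonzero; the default value in [insubd] only makes the definition
    total. *)
Definition pairg (y : F) : sl2 F :=
  insubd (sl2_one F) (mat2 diag0 y ((diag0 * diag1 - 1) / y) diag1).

Lemma pairgE y : y != 0 ->
  pairg y = mat2 diag0 y ((diag0 * diag1 - 1) / y) diag1 :> 'M_2.
Proof.
move=> y0; rewrite [LHS]insubdK // unfold_in det2E !mxE /=.
by apply/eqP; field.
Qed.

Lemma pairg_uniq (g : sl2 F) : g 0 0 = diag0 -> g 1 1 = diag1 -> g 0 1 != 0 ->
  g = pairg (g 0 1).
Proof.
move=> E0 E1 g01; apply: sl2_eqP; rewrite pairgE // !mxE //=.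
by apply: (mulfI g01); rewrite [RHS]mulrC mulfVK // -E0 -E1 -(sl2_detE g); ring.
Qed.

Lemma pairg_conj j y : y != 0 ->
  (ba ^+ j * pairg y * (ba ^+ j)^-1)%g = pairg (e ^+ (2 * j) * y).
Proof.
move=> y0; have ej0 : e ^+ j != 0 by rewrite expf_neq0 ?e_neq0.
have [V00 V01 V10 V11] := sl2_V (ba ^+ j)%g.
have ey0 : e ^+ (2 * j) * y != 0 by rewrite mulf_neq0 ?expf_neq0 ?e_neq0.
have Ej : e ^+ (2 * j) = e ^+ j * e ^+ j by rewrite -exprD addnn mul2n.
by apply: sl2_eqP; rewrite !sl2_M ?V00 ?V01 ?V10 ?V11 baX !pairgE // !mxE /= ?Ej;
  field; rewrite ?y0 ?ej0.
Qed.

(* The square classes e^b (F^* )^2 of g 0 1 for which (g, g^-1 a^k) lies in the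
   classes of L1 and L2; see mem_pair. *)
Definition pair_sq (b : bool) : bool := allowed L1 b && allowed L2 (b (+) odd k).

(** Both traces are right by the choice of the diagonal. The upper right entry of g^-1 a^k is -e^-k
    times that of g, so its square class changes with the parity of k. *)
Lemma mem_pair (b : bool) (j : nat) : let g := pairg (e ^+ (b + 2 * j)) in
  (g \in cl1) && ((g^-1 * ba ^+ k)%g \in cl2) = pair_sq b.
Proof.
set y := e ^+ _ => g; have y0 : y != 0 by rewrite expf_neq0 ?e_neq0.
have e0 := e_neq0 D.
have gE := pairgE y0; have [V00 V01 V10 V11] := sl2_V g.
have g01 : g 0 1 = e ^+ b * (e ^+ j) ^+ 2.
  by rewrite gE !mxE /= /y exprD mulnC exprM.
(* Only b = 0 with k odd leaves a nontrivial square: e^-1 is e times the square of e^-1. *)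
have [c c0 Ec] : exists2 c, c != 0 & e ^+ b * e ^- odd k = e ^+ (b (+) odd k) * c ^+ 2.
  case: (b) (odd k) => [] [].
  - by exists 1; rewrite ?oner_neq0 // expr1n mulr1 mulfV ?expf_neq0.
  - by exists 1; rewrite ?oner_neq0 // expr1n invr1.
  - by exists e^-1; rewrite ?invr_neq0 //= expr0 expr1; field.
  - by exists 1; rewrite ?oner_neq0 // expr1n invr1.
have M01 : (g^-1 * ba ^+ k)%g 0 1 =
    e ^+ (b (+) odd k) * (c * e ^+ j * e ^+ h / e ^+ k./2) ^+ 2.
  rewrite sl2_M V00 V01 baX g01 !mxE /= mulr0 add0r.
  have Ek : e ^- k = e ^- odd k * (e ^+ k./2)^-1 ^+ 2.
    by rewrite exprVn -invfM -exprM -exprD muln2 odd_double_half.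
  transitivity (e ^+ b * e ^- odd k * (- ((e ^+ j) ^+ 2 * (e ^+ k./2)^-1 ^+ 2))).
    by rewrite Ek; ring.
  by rewrite Ec !exprMn e_quarter; ring.
rewrite (mem_class_lpt _ g01) ?expf_neq0 // (mem_class_lpt _ M01); last first.
  by rewrite !mulf_neq0 ?invr_eq0 ?expf_neq0.
have -> : tr2 g = tr2 (lpt L1) by rewrite /tr2 gE !mxE /= /diag1 addrC subrK.
have -> : tr2 (g^-1 * ba ^+ k)%g = tr2 (lpt L2).
  by rewrite -diag_tr /tr2 !sl2_M baX V00 V01 V10 V11 gE !mxE /= !mulr0 addr0 add0r.
by rewrite !eqxx.
Qed.

(** The entry g 0 1 determines g, and conjugation by a^j multiplies it by e^(2j), so one
    representative per square class suffices. *)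
Lemma pair_orbit g : g \in cl1 -> (g^-1 * ba ^+ k)%g \in cl2 ->
  exists b : bool, exists j : nat,
    pair_sq b /\ g = (ba ^+ j * pairg (e ^+ b)%R * (ba ^+ j)^-1)%g.
Proof.
move=> g1 g2; have [E0 E1 g01] := pair_entries g1 g2.
have Eg := pairg_uniq E0 E1 g01; have [b [j Ey]] := sqclass_exists g01.
exists b, j; split; first by rewrite -(mem_pair b j) -Ey -Eg g1 g2.
by rewrite pairg_conj ?expf_neq0 ?e_neq0 // -exprD addnC -Ey.
Qed.

Variable R : realType.
Local Notation T := (dtensor (lobj R L1) (lobj R L2)).

(** The dimension counts the pairs, and the exponents b + 2j with j < 2h give distinct entries: 2h
    pairs for each admissible square class. *)
Lemma leq_dim_dgr_tensor :
  ((pair_sq false + pair_sq true) * (2 * h) <= \dim (dgr T (ba ^+ k)%g))%N.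
Proof.
rewrite dim_dtensor_gr.
pose P := [set p : sl2 F * sl2 F |
  [&& (p.1 * p.2 == ba ^+ k)%g, p.1 \in cl1 & p.2 \in cl2]].
have -> : (\sum_(p : sl2 F * sl2 F | (p.1 * p.2 == ba ^+ k)%g)
   \dim (dgr (lobj R L1) p.1) * \dim (dgr (lobj R L2) p.2))%N = #|P|.
  rewrite -sum1_card big_mkcond [RHS]big_mkcond; apply: eq_bigr => p _.
  rewrite !dim_dgr_dsimple inE; case: (_ == _) => //=.
  by case: (_ \in cl1); case: (_ \in cl2).
pose A := [set bj : bool * 'I_(2 * h) | pair_sq bj.1].
pose g (bj : bool * 'I_(2 * h)) := pairg (e ^+ (bj.1 + 2 * bj.2)).
pose phi bj := (g bj, ((g bj)^-1 * ba ^+ k)%g).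
have phi_inj : injective phi.
  move=> [b j] [b' j'] [/(congr1 (fun x : sl2 F => x 0 1)) + _].
  rewrite !pairgE ?expf_neq0 ?e_neq0 // !mxE /= => /eqP.
  rewrite (eq_prim_root_expr (e_prim D)) qE /= !modn_small.
  - move=> /eqP E; have Eb : b = b' by move: E; case: (b) (b') => [] [] /=; lia.
    by congr pair => //; apply: val_inj => /=; move: E; rewrite Eb; lia.
  - by have := ltn_ord j'; case: (b') => /=; lia.
  - by have := ltn_ord j; case: (b) => /=; lia.
have -> : ((pair_sq false + pair_sq true) * (2 * h))%N = #|A|.
  have -> : A = setX [set b | pair_sq b] [set: 'I_(2 * h)].
    by apply/setP=> -[b j]; rewrite !inE andbT.
  rewrite cardsX cardsT card_ord -sum1dep_card big_mkcond big_bool /= addnC.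
  by do 2 case: (pair_sq _).
rewrite -(card_imset _ phi_inj) subset_leq_card //.
apply/subsetP=> _ /imsetP[[b j] bjA ->]; rewrite !inE /= mulKVg eqxx /=.
by rewrite mem_pair; rewrite inE in bjA.
Qed.

(** The tensor at the base point of the orbit of square class b; it vanishes if that class is not
    admissible. *)
Definition orbvec (b : bool) : T :=
  tens (dsimple_delta (lrep R L1) (pairg (e ^+ b)))
       (dsimple_delta (lrep R L2) ((pairg (e ^+ b)%R)^-1 * ba ^+ k)%g).

Lemma orbvec_dgr b : orbvec b \in dgr T (ba ^+ k)%g.
Proof.
rewrite -[X in dgr T X](mulKVg (pairg (e ^+ b))).
by apply: mem_dgr_tens; rewrite dgr_dsimple memv_line.
Qed.

(** The image is stable under a, so it contains the tensors of a whole orbit as soon as it contains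
    one of them. *)
Lemma dgr_tensor_sub (W : dobject R[i] (sl2 F)) (f : 'Hom(W, T)) : dmorphism f ->
  (forall b, pair_sq b -> orbvec b \in limg f) -> (dgr T (ba ^+ k)%g <= limg f)%VS.
Proof.
move=> fP fb; apply/subv_sumP=> -[x y] /= /eqP xy; apply: tens_vsP => u v.
change (u \in dgr (dsimple (lrep R L1)) x -> v \in dgr (dsimple (lrep R L2)) y ->
  tens u v \in limg f) => ux vy.
have [x1|/dsimple_delta_eq0 x1] := boolP (x \in cl1); last first.
  move: ux; rewrite dgr_dsimple x1 => /vlineP[c ->].
  rewrite (_ : c *: (0 : dsimple (lrep R L1)) = 0 *: 0); last by rewrite !scaler0.
  by rewrite tensZl scale0r mem0v.
have [y2|/dsimple_delta_eq0 y2] := boolP (y \in cl2); last first.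
  move: vy; rewrite dgr_dsimple y2 => /vlineP[c ->].
  by rewrite scaler0 linear0 mem0v.
have Ey : y = (x^-1 * ba ^+ k)%g by rewrite -xy mulKg.
have [b [j [bP Ex]]] := pair_orbit x1 (etrans (congr1 (fun z => z \in cl2) (esym Ey)) y2).
set g := pairg _ in Ex.
(* Since a^j commutes with a^k, conjugating g by a^j conjugates g^-1 a^k in the same way. *)
have {}Ey : y = (ba ^+ j * (g^-1 * ba ^+ k) * (ba ^+ j)^-1)%g.
  have cjk : commute (ba ^+ k)%g (ba ^+ j)^-1%g by apply: commuteV; apply: commuteX2.
  by rewrite Ey Ex !invMg invgK -!mulgA cjk.
move: ux vy; rewrite Ex Ey -!dact_gr !dgr_dsimple.
move=> /memv_imgP[_ /vlineP[c ->] ->] /memv_imgP[_ /vlineP[c' ->] ->].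
rewrite -tmapE; apply: (dact_img_stable (Y := T)) => //.
by rewrite tensZl linearZ /= !memvZ // fb.
Qed.

End Pairs.

(** * Decomposition of the component at a^k *)

Lemma sum_odd_eq (b : bool) m : (\sum_(1 <= u < (2 * m).+1 | u == b %[mod 2]) 1 = m)%N.
Proof.
rewrite big_mkcond; elim: m => [|m IH]; first by rewrite big_geq.
rewrite mulnS !add2n big_nat_recr //= big_nat_recr //= IH !modn2 /= mul2n odd_double.
by case: (b); rewrite /= ?addn0 addn1.
Qed.

Section Decomposition.

Variables (R : realType) (D : sl2_data) (k : nat).
Hypothesis hk : (1 <= k <= 2 * dh D - 1)%N.
Variables L1 L2 : label D.
Hypothesis hgen : forall s1 s2 : bool,
  diota D (e D) ^+ k != lval L1 ^ ((-1) ^+ s1 : int) * lval L2 ^ ((-1) ^+ s2 : int).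

Local Notation F := (dF D).
Local Notation h := (dh D).
Local Notation N := (q D).-1.
Local Notation ba := (ba D).
Local Notation T := (dtensor (lobj R L1) (lobj R L2)).
Local Notation A u := (lobj R (LA hk u%:R)).
Local Notation w b := (orbvec k L1 L2 R b).

Lemma N_def : N = (2 * (2 * h))%N. Proof. by rewrite qE /=; lia. Qed.

Lemma N_gt0 : (0 < N)%N. Proof. by rewrite N_def; have := h_gt0 D; lia. Qed.

Lemma baN : (ba ^+ N)%g = 1%g.
Proof.
apply: val_inj; rewrite /= baX (prim_expr_order (e_prim D)) invr1.
by apply: mat2P; rewrite !mxE.
Qed.

Definition eigv (b : bool) (u : nat) : T := eigvec ba N (zeta R N ^+ u) (w b).

Lemma zetaXN u : (zeta R N ^+ u) ^+ N = 1.
Proof. by rewrite exprAC zeta_unity ?expr1n // N_gt0. Qed.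

(** The vector has degree a^k, and the centralizer, generated by a, acts on it by u^*; Frobenius
    reciprocity applies. *)
Lemma covers_eigv b u : covers (A u) <[eigv b u]>%VS.
Proof.
apply: covers_dsimple => [|g].
  by apply: dgr_eigvec (orbvec_dgr _ _ _ _ _); apply: commuteX.
move=> Cg; have /cycleP[i ->] : g \in <[ba]>%g by rewrite -(cent_ba hk).
rewrite eigvec_actX ?zetaXN ?baN //=; congr (_ *: _).
(* The label reduces u modulo q - 1, so u = q - 1 becomes 0; the power of zeta is unchanged. *)
rewrite chiAE mxE eqxx mulr1n val_Zp_nat; last by rewrite N_def; have := h_gt0 D; lia.
by rewrite mulnC exprM expr_mod ?zeta_unity ?N_gt0.
Qed.

Lemma orbvec_half b :
  dact T (ba ^+ (2 * h))%g (w b) = (-1) ^+ (nu_of R L1 L2) *: w b.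
Proof.
rewrite ba_half.
rewrite [LHS]tmapE !dact_dsimple_central; try by move=> g; exact: bs_central.
rewrite !lrep_bs !lfunE /= !id_lfunE tensZl linearZ /= scalerA !mxE !eqxx !mulr1n.
by rewrite nu_ofE signr_addb.
Qed.

(** The vector is a multiple of the sum of its projections, and those of the wrong parity vanish
    because a^(2h) = -1 acts by the sign of nu. *)
Lemma orbvec_sub_eigv (V : {vspace T}) b :
  (forall u, (1 <= u < q D)%N -> u = nu_of R L1 L2 %[mod 2] -> eigv b u \in V) ->
  w b \in V.
Proof.
move=> uV; have N0 : N%:R != 0 :> R[i] by rewrite pnatr_eq0 -lt0n N_gt0.
rewrite -[w b]scale1r -(mulVf N0) -scalerA memvZ //.
rewrite -(sum_eigvec ba _ (zeta_prim R N_gt0)) big_nat_cond memv_suml // => u.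
rewrite andbT => /andP[u1 u2]; have uq : (1 <= u < q D)%N by rewrite u1 qE in u2 *.
have [/eqP|neq] := boolP (u == nu_of R L1 L2 %[mod 2]); first exact: uV.
rewrite (eigvec_eq0 baN (zetaXN u) (orbvec_half b)) ?mem0v //.
rewrite exprAC {1}N_def zeta_half ?muln_gt0 ?h_gt0 // -[_ ^+ u]signr_odd.
move: neq; rewrite !modn2 oddb; case: (odd u); case: (nu_of _ _ _) => //= _;
  by rewrite ?expr0 ?expr1 ?[1 == _]eq_sym eqNr oner_eq0.
Qed.

Local Notation cl := (ba ^+ k ^: [set: sl2 F])%g.
Local Notation nb := (pair_sq k L1 L2 false + pair_sq k L1 L2 true)%N.

Lemma leq_dim_supp : (#|cl| * (nb * (2 * h)) <= dim (dsupp T (ba ^+ k)%g))%N.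
Proof. by rewrite dim_dsupp dim_supp_vs leq_mul2l leq_dim_dgr_tensor ?orbT. Qed.

(* Surjectivity onto the [a^k]-part follows from orbvec_sub_eigv, and the bound on
   the dimension of W turns it into an isomorphism. *)
Lemma dsupp_tensor_iso (W : dobject R[i] (sl2 F)) (V : {vspace T}) :
    covers W V -> (dim W <= #|cl| * (nb * (2 * h)))%N ->
    (forall b u, pair_sq k L1 L2 b -> (1 <= u < q D)%N ->
       u = nu_of R L1 L2 %[mod 2] -> eigv b u \in V) ->
  diso (dsupp T (ba ^+ k)%g) W.
Proof.
move=> [f fP Vf] dW eV; apply: (dsupp_iso fP).
  apply: supp_vs_sub_limg => //; apply: (dgr_tensor_sub hk hgen fP) => b bP.
  by apply: (subvP Vf); apply: orbvec_sub_eigv => u; apply: eV.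
by rewrite -dim_dsupp (leq_trans dW) ?leq_dim_supp.
Qed.

Lemma dim_A u : dim (A u) = #|cl|.
Proof. by rewrite dim_dsimple muln1. Qed.

Lemma dim_big_const (W : nat -> dobject R[i] (sl2 F)) (b : bool) m :
  (forall u, dim (W u) = m) ->
  dim (\big[@dsum _ _/dzero R[i] (sl2 F)]_(1 <= u < q D | u == b %[mod 2]) W u)
    = (m * (2 * h))%N.
Proof.
move=> dW; rewrite dim_big_dsum (eq_bigr (fun=> (m * 1)%N)); last by move=> u; rewrite dW muln1.
by rewrite -big_distrr /= qE (_ : 4 * h = 2 * (2 * h))%N ?sum_odd_eq //; lia.
Qed.

(** The two copies of A_k^u come from the two orbits. *)
Lemma dsupp_tensor_double : pair_sq k L1 L2 false -> pair_sq k L1 L2 true ->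
  diso (dsupp T (ba ^+ k)%g)
    (\big[@dsum _ _/dzero R[i] (sl2 F)]_(1 <= u < q D | u == nu_of R L1 L2 %[mod 2])
       dsum (A u) (A u)).
Proof.
move=> b0 b1; apply: dsupp_tensor_iso.
- apply: covers_big => u _; apply: covers_dsum.
    exact: (covers_eigv false u).
  exact: (covers_eigv true u).
- rewrite (@dim_big_const _ _ (#|cl| * 2)) ?b0 ?b1; last by move=> u; rewrite dim_dsum dim_A; lia.
  by rewrite -mulnA.
move=> b u _ u1 /eqP u2; rewrite memvE big_mkcond (bigD1_seq u) ?mem_index_iota ?iota_uniq //= u2.
apply: subv_trans (addvSl _ _).
by case: b; [exact: addvSr | exact: addvSl].
Qed.

Lemma dsupp_tensor_single b0 : (forall b, pair_sq k L1 L2 b = (b == b0)) ->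
  diso (dsupp T (ba ^+ k)%g)
    (\big[@dsum _ _/dzero R[i] (sl2 F)]_(1 <= u < q D | u == nu_of R L1 L2 %[mod 2]) A u).
Proof.
move=> bE; apply: dsupp_tensor_iso.
- by apply: covers_big => u _; exact: (covers_eigv b0 u).
- by rewrite (@dim_big_const _ _ #|cl| dim_A) !bE; case: (b0); rewrite mul1n.
move=> b u; rewrite bE => /eqP -> u1 /eqP u2.
rewrite memvE big_mkcond (bigD1_seq u) ?mem_index_iota ?iota_uniq //= u2.
exact: addvSl.
Qed.

Lemma dsupp_tensor_zero : (forall b, ~~ pair_sq k L1 L2 b) ->
  diso (dsupp T (ba ^+ k)%g) (dzero R[i] (sl2 F)).
Proof.
move=> bE; apply: dsupp_tensor_iso (covers0 _) _ _; first by rewrite dim_dzero.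
by move=> b u; rewrite (negbTE (bE b)).
Qed.

Lemma dsupp_tensor_nonzero b : pair_sq k L1 L2 b ->
  ~ diso (dsupp T (ba ^+ k)%g) (dzero R[i] (sl2 F)).
Proof.
move=> bP /diso_dzero_dim d0.
have c0 : (0 < #|cl|)%N by apply/card_gt0P; exists (ba ^+ k)%g; apply: class_refl.
have n0 : (0 < nb)%N by case: b bP => ->; rewrite ?addn1.
by have := leq_dim_supp; rewrite d0 leqNgt !muln_gt0 c0 n0 h_gt0.
Qed.

End Decomposition.

(** With both objects in the B-family the prescribed square classes may be incompatible, and the
    component is then zero; hence the nonvanishing premise in the second clause. Together with the
    third clause, it holds exactly under the congruence. *)
Theorem mainTheorem1 (R : realType) (D : sl2_data) (k : nat)
    (hk : (1 <= k <= 2 * dh D - 1)%N) (L1 L2 : label D)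
    (hgen : forall s1 s2 : bool,
      diota D (e D) ^+ k != lval L1 ^ ((-1) ^+ s1 : int) * lval L2 ^ ((-1) ^+ s2 : int)) :
  let X := dtensor (lobj R L1) (lobj R L2) in
  let Xk := dsupp X (ba D ^+ k)%g in
  let nu := nu_of R L1 L2 in
  let A (u : nat) := lobj R (LA hk u%:R) in
  let zero := dzero R[i] (sl2 (dF D)) in
  [/\ (~~ isB L1 && ~~ isB L2 ->
        diso Xk (\big[@dsum _ _/zero]_(1 <= u < q D | u == nu %[mod 2])
                   dsum (A u) (A u))),
      (isB L1 || isB L2 ->
       (isB L1 && isB L2 -> ~ diso Xk zero) ->
        diso Xk (\big[@dsum _ _/zero]_(1 <= u < q D | u == nu %[mod 2]) A u) /\
        (forall mu1 eps1 nu1 v1 mu2 eps2 nu2 v2,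
           L1 = LB mu1 eps1 nu1 v1 -> L2 = LB mu2 eps2 nu2 v2 ->
           (k%:Z = eps1%:Z - eps2%:Z %[mod 2])%Z)) &
      (forall mu1 eps1 nu1 v1 mu2 eps2 nu2 v2,
         L1 = LB mu1 eps1 nu1 v1 -> L2 = LB mu2 eps2 nu2 v2 ->
         (k%:Z = eps1%:Z - eps2%:Z %[mod 2])%Z -> ~ diso Xk zero)].
Proof.
move=> X Xk nu A zero.
(* The congruence says that the change of square class from g to g^-1 a^k turns the first prescribed
   class into the second. *)
have par (a b : bool) : (k%:Z = a%:Z - b%:Z %[mod 2])%Z <-> a (+) odd k = b.
  by split; case: a; case: b; case: (boolP (odd k)) => /=; lia.
split.
- case/andP=> B1 B2; apply: (dsupp_tensor_double R hk hgen).
    by rewrite /pair_sq; case: (L1) (L2) B1 B2 => [? ? ?|? ? ? ?|? ? ?] [? ? ?|? ? ? ?|? ? ?].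
  by rewrite /pair_sq; case: (L1) (L2) B1 B2 => [? ? ?|? ? ? ?|? ? ?] [? ? ?|? ? ? ?|? ? ?].
- move=> B12 nz.
  have [b0 b0P] : exists b, pair_sq k L1 L2 b.
    have [B12'|nB] := boolP (isB L1 && isB L2).
      have [b0P|b0N] := boolP (pair_sq k L1 L2 false); first by exists false.
      have [b1P|b1N] := boolP (pair_sq k L1 L2 true); first by exists true.
      (* With no admissible orbit the component would be zero. *)
      by case: (nz B12'); apply: (dsupp_tensor_zero R hk hgen) => -[].
    rewrite /pair_sq; case: (L1) (L2) B12 nB => [? ? ?|? eps ? ?|? ? ?] [? ? ?|? eps' ? ?|? ? ?] //= _ _;
      try (by exists eps; rewrite eqxx); by exists (eps' (+) odd k); rewrite addbK eqxx.
  split.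
    apply: (dsupp_tensor_single R hk hgen (b0 := b0)) => b; move: b0P; rewrite /pair_sq.
    case: (L1) (L2) B12 => [? ? ?|? eps ? ?|? ? ?] [? ? ?|? eps' ? ?|? ? ?] //= _;
      by case: (b0) (b) (odd k) => [] [] []; try case: eps; try case: eps'.
  move=> mu1 eps1 nu1 v1 mu2 eps2 nu2 v2 E1 E2; apply/par.
  by move: b0P; rewrite /pair_sq E1 E2 /= => /andP[/eqP -> /eqP ->].
move=> mu1 eps1 nu1 v1 mu2 eps2 nu2 v2 E1 E2 /par Ek.
apply: (dsupp_tensor_nonzero hk (b := eps1)).
by rewrite /pair_sq E1 E2 /= Ek !eqxx.
Qed.
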